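(* Let $\Phi$ be a Young function so that $0<u_\Phi=1/p<1$, let $w\in A_p$, and let $S$ be a sublinear operator such that $$\int_{\mathbb{R}^n}\Phi(|Sf(y)|)\,w(y)\,dy\le c\int_{\mathbb{R}^n}\Phi(|f(y)|)\,w(y)\,dy$$ and such that for any cube $Q$, if $x\in Q$ and $\mathrm{supp}(f)\subset\mathbb{R}^n\setminus2Q$, then $$|Sf(x)|\le\int_{\mathbb{R}^n}\frac{|f(y)|}{|x-y|^n}\,dy.$$ Let $\phi(x,t),\psi(x,t)$ be such that for all $x\in\mathbb{R}^n$ and $l>0$, $$\psi(x,l)\int_l^\infty\frac{1}{\phi(x,t)}\,\frac{dt}{t}\le c.$$ Then $$\|Sf\|_{\mathcal{M}^{\Phi,\psi}_w}\le c\,\|f\|_{\mathcal{M}^{\Phi,\phi}_w}.$$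
   Context: All cubes have sides parallel to the axes; $Q(x_Q,l_Q)$ is the cube with center $x_Q$ and sidelength $l_Q$, and $2Q$ is the concentric cube with twice the sidelength. A continuous function $\Phi$ on $[0,\infty)$ satisfies condition $C$ if it is increasing, $\Phi(0)=0$, and $\Phi(2\tau)\le c\,\Phi(\tau)$ for all $\tau>0$; a function satisfying condition $C$ which is convex and such that $\Phi(\tau)\to\infty$ (or, more generally, $\Phi(\tau)/\tau\to\infty$) as $\tau\to\infty$ is called a Young function. For a Young function $\Phi$ such that it and its conjugate $\overline\Phi(\tau)=\sup_{\sigma>0}(\sigma\tau-\Phi(\sigma))$ satisfy the $\Delta_2$ condition, the upper index of $L^\Phi$ is $$u_\Phi=\lim_{\sigma\to0^+}-\frac{\ln h(\sigma)}{\ln\sigma},\qquad h(\sigma)=\sup_{\tau>0}\frac{\Phi^{-1}(\tau)}{\Phi^{-1}(\sigma\tau)}.$$ $A_p$ is the Muckenhoupt class. The functions $\phi,\psi$ are continuous on $\mathbb{R}^n\times\mathbb{R}^+$ and such that for each $x\in\mathbb{R}^n$ they are increasing in $t\in[0,\infty)$ and vanish at $t=0$. With $\|f\|_{L^\Phi_w(Q)}=\inf\{\lambda>0:\frac{1}{w(Q)}\int_Q\Phi(|f(y)|/\lambda)\,w(y)\,dy\le1\}$, where $w(Q)=\int_Qw$, the generalized weighted Orlicz-Morrey (quasi)norm is $$\|f\|_{\mathcal{M}^{\Phi,\phi}_w}=\sup_{Q(x_Q,l_Q)\subset\mathbb{R}^n}\phi(x_Q,l_Q)\,\|f\|_{L^\Phi_w(Q)}.$$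 *)

(* Defs.v *)
From HB Require Import structures.
From mathcomp Require Import all_boot all_order all_algebra.
From mathcomp Require Import all_classical all_reals all_analysis.

Set Implicit Arguments.
Unset Strict Implicit.
Unset Printing Implicit Defensive.

Import Order.TTheory GRing.Theory Num.Theory.
Import numFieldNormedType.Exports.

Local Open Scope classical_set_scope.
Local Open Scope ring_scope.

(* The library provides no measurable structure on row vectors. As for
   [n.-tuple], we take the sigma-algebra generated by the coordinates, i.e. the
   Borel sigma-algebra of R^n. *)
Section measurable_rV.
Context {R : realType} (n : nat).

Let coords (i : 'I_n) (x : 'rV[R]_n) : measurableTypeR R := x ord0 i.

Let rV_set0 : g_sigma_preimage coords set0.
Proof. exact: sigma_algebra0. Qed.

Let rV_setC A : g_sigma_preimage coords A -> g_sigma_preimage coords (~` A).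
Proof. exact: sigma_algebraC. Qed.

Let rV_bigcup (F : _^nat) : (forall i, g_sigma_preimage coords (F i)) ->
  g_sigma_preimage coords (\bigcup_i (F i)).
Proof. exact: sigma_algebra_bigcup. Qed.

HB.instance Definition _ :=
  @isMeasurable.Build default_measure_display 'rV[R]_n
    (g_sigma_preimage coords) rV_set0 rV_setC rV_bigcup.

End measurable_rV.

Lemma measurable_rV_coord (R : realType) (n : nat) (i : 'I_n) :
  measurable_fun [set: 'rV[R]_n] (fun x => x ord0 i : measurableTypeR R).
Proof.
move=> _ Y mY; rewrite setTI; apply: sub_sigma_algebra => /=.
rewrite -bigcup_seq/=; exists i => /=; first by rewrite mem_index_enum.
by exists Y => //; rewrite setTI.
Qed.

Lemma measurable_fun_rV (R : realType) d (T : measurableType d) (n : nat)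
    (f : T -> 'rV[R]_n) :
  (forall i, measurable_fun [set: T] (fun t => f t ord0 i : measurableTypeR R)) ->
  measurable_fun [set: T] f.
Proof.
move=> mf; pose c (i : 'I_n) (x : 'rV[R]_n) : measurableTypeR R := x ord0 i.
have H : g_sigma_preimage (fun i => c i \o f) `<=` @measurable _ T.
  apply: smallest_sub; first exact: sigma_algebra_measurable.
  rewrite -bigcup_seq; apply: bigcup_sub => i _.
  by move=> A [B mB <-]; exact: mf.
rewrite g_sigma_preimage_comp in H.
by move=> _ A mA; apply: H; exists A.
Qed.

Definition consRn (R : realType) (n : nat)
    (xv : measurableTypeR R * 'rV[R]_n) : 'rV[R]_n.+1 :=
  row_mx (xv.1%:M : 'rV[R]_1) xv.2.

Lemma consRn0 (R : realType) n (xv : measurableTypeR R * 'rV[R]_n) :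
  consRn xv ord0 ord0 = xv.1.
Proof.
transitivity ((row_mx (xv.1%:M : 'rV[R]_1) xv.2) ord0 (lshift n (ord0 : 'I_1))).
  by congr (consRn xv _ _); exact/val_inj.
by rewrite row_mxEl mxE eqxx.
Qed.

Lemma consRnS (R : realType) n (xv : measurableTypeR R * 'rV[R]_n) (i : 'I_n) :
  consRn xv ord0 (lift ord0 i) = xv.2 ord0 i.
Proof.
transitivity ((row_mx (xv.1%:M : 'rV[R]_1) xv.2) ord0 (rshift 1 i)).
  by congr (consRn xv _ _); exact/val_inj.
by rewrite row_mxEr.
Qed.

Lemma measurable_consRn (R : realType) (n : nat) :
  measurable_fun setT (@consRn R n).
Proof.
apply: measurable_fun_rV => i; case: (unliftP ord0 i) => [j|] ->.
  under eq_fun do rewrite consRnS.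
  exact: (measurableT_comp (@measurable_rV_coord R n j) measurable_snd).
by under eq_fun do rewrite consRn0; exact: measurable_fst.
Qed.

Definition unconsRn (R : realType) (n : nat) (x : 'rV[R]_n.+1) :
    measurableTypeR R * 'rV[R]_n :=
  (x ord0 ord0, \row_i x ord0 (lift ord0 i)).

Lemma consRnK (R : realType) (n : nat) : cancel (@consRn R n) (@unconsRn R n).
Proof.
move=> [x v]; rewrite /unconsRn consRn0; congr pair.
by apply/rowP => i; rewrite mxE consRnS.
Qed.

Lemma measurable_unconsRn (R : realType) (n : nat) :
  measurable_fun setT (@unconsRn R n).
Proof.
apply: measurable_fun_pair; first exact: measurable_rV_coord.
apply: measurable_fun_rV => i; under eq_fun do rewrite mxE.
exact: measurable_rV_coord.
Qed.

Section lebesgueRn_step.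
Context {R : realType} (n : nat)
  (m : {sigma_finite_measure set 'rV[R]_n -> \bar R}).
Local Open Scope ereal_scope.

Let mu1 : {sigma_finite_measure set (measurableTypeR R) -> \bar R} :=
  @lebesgue_measure R.

Let leb : set 'rV[R]_n.+1 -> \bar R := pushforward (mu1 \x m) (@consRn R n).

Let mpre (A : set 'rV[R]_n.+1) :
  measurable A -> measurable (@consRn R n @^-1` A).
Proof.
by move=> mA; rewrite -[X in measurable X]setTI; exact: measurable_consRn.
Qed.

Let leb0 : leb set0 = 0.
Proof. by rewrite /leb /pushforward preimage_set0 measure0. Qed.

Let leb_ge0 A : 0 <= leb A.
Proof. by rewrite /leb /pushforward; exact: measure_ge0. Qed.

Let leb_sigma_additive : semi_sigma_additive leb.
Proof.
move=> F mF tF mUF; rewrite /leb /pushforward preimage_bigcup.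
apply: measure_semi_sigma_additive.
- by move=> k; exact: mpre.
- apply/trivIsetP => /= i j _ _ ij; rewrite -preimage_setI.
  by move/trivIsetP : tF => /(_ _ _ _ _ ij) ->//; rewrite preimage_set0.
- by rewrite -preimage_bigcup; exact: mpre.
Qed.

HB.instance Definition _ := isMeasure.Build _ _ _ leb
  leb0 leb_ge0 leb_sigma_additive.

Let leb_sigma_finite : sigma_finite setT leb.
Proof.
have /sigma_finiteP[F [TF ndF Foo]] := sigma_finiteT mu1.
have /sigma_finiteP[G [TG ndG Goo]] := sigma_finiteT m.
exists (fun k => @unconsRn R n @^-1` (F k `*` G k)).
  rewrite -preimage_bigcup (_ : \bigcup_k (F k `*` G k) = setT)//.
  rewrite -setXTT TF TG predeqE => -[x y]; split.
    by move=> [k _ []/= ? ?]; split; exists k.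
  move=> [/= [k _ Fkx] [l _ Gly]]; exists (maxn k l) => //; split.
  - by move: x Fkx; exact/subsetPset/ndF/leq_maxl.
  - by move: y Gly; exact/subsetPset/ndG/leq_maxr.
move=> k; have [mF Fk] := Foo k; have [mG Gk] := Goo k; split.
  rewrite -[X in measurable X]setTI.
  by apply: measurable_unconsRn => //; exact: measurableX.
rewrite /leb /pushforward -comp_preimage.
rewrite (_ : _ \o _ = idfun); last by apply/funext => x /=; rewrite consRnK.
by rewrite preimage_id product_measure1E// lte_mul_pinfty// ge0_fin_numE.
Qed.

HB.instance Definition _ := Measure_isSigmaFinite.Build _ _ _ leb
  leb_sigma_finite.

Definition lebesgueRnS : {sigma_finite_measure set 'rV[R]_n.+1 -> \bar R} :=
  leb.

Lemma lebesgueRnSE (A : set R) (B : set 'rV[R]_n) :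
  measurable (A : set (measurableTypeR R)) -> measurable B ->
  lebesgueRnS [set x | A (x ord0 ord0) /\ B (\row_i x ord0 (lift ord0 i))] =
  lebesgue_measure A * m B.
Proof.
move=> mA mB; rewrite -[RHS](product_measure1E mu1 m)//=.
rewrite /leb /pushforward; congr (_ _); rewrite predeqE => -[x v] /=.
rewrite consRn0 (_ : \row_i _ = v)//.
by apply/rowP => i; rewrite mxE consRnS.
Qed.

End lebesgueRn_step.

(* Lebesgue measure on R^n.+1 is the image of the product measure under
   [consRn : R * R^n -> R^n.+1]; [lebesgueRn_box] characterizes it. *)
Fixpoint lebesgueRn {R : realType} (n : nat) :
    {sigma_finite_measure set 'rV[R]_n -> \bar R} :=
  match n with
  | 0 => @dirac _ 'rV[R]_0 0 R
  | n'.+1 => lebesgueRnS (lebesgueRn n')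
  end.

Lemma measurable_rV_box (R : realType) (n : nat) (a b : 'I_n -> R) :
  measurable [set x : 'rV[R]_n | forall i, x ord0 i \in `[a i, b i]].
Proof.
rewrite (_ : mkset _ =
  \bigcap_i ((fun x : 'rV[R]_n => x ord0 i : measurableTypeR R) @^-1`
    `[a i, b i]%classic)); last first.
  by apply/seteqP; split=> x /= h i; [move=> _|]; exact: h.
apply: fin_bigcap_measurable => // i _.
rewrite -[X in measurable X]setTI; apply: measurable_rV_coord => //.
Qed.

Lemma lebesgueRn_box (R : realType) (n : nat) (a b : 'I_n -> R) :
  (forall i, a i <= b i) ->
  lebesgueRn n [set x : 'rV[R]_n | forall i, x ord0 i \in `[a i, b i]] =
  (\prod_i (b i - a i))%:E.
Proof.
elim: n a b => [|n IH] a b ab.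
  by rewrite big_ord0 /= diracE mem_set// => -[].
rewrite big_ord_recl EFinM -IH//.
have := lebesgue_measure_itv `[a ord0, b ord0]; rewrite /= lte_fin.
have -> : (if a ord0 < b ord0 then ((b ord0)%:E - (a ord0)%:E)%E else 0%E) =
    (b ord0 - a ord0)%:E.
  case: ltP => // ba; have -> : b ord0 = a ord0 by apply/eqP; rewrite eq_le ba ab.
  by rewrite subrr.
move=> <-; rewrite -lebesgueRnSE//; last exact: measurable_rV_box.
congr (_ _); apply/seteqP; split=> x /= => [h|[h0 h] i].
  by split => [|i]; rewrite ?mxE; exact: h.
case: (unliftP ord0 i) => [j|] -> //.
by have := h j; rewrite mxE.
Qed.

Section geometry.
Context {R : realType} (n : nat).

Definition enorm (x : 'rV[R]_n) : R := Num.sqrt (\sum_i x ord0 i ^+ 2).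

Definition cube (x : 'rV[R]_n) (l : R) : set 'rV[R]_n :=
  [set y | forall i, `|y ord0 i - x ord0 i| <= l / 2].

Definition supp (f : 'rV[R]_n -> R) : set 'rV[R]_n :=
  closure [set y | f y != 0].

End geometry.

Section young.
Context {R : realType}.
Implicit Types (F : R -> \bar R) (Phi : R -> R).

Definition delta2 F : Prop :=
  exists c : R, forall t : R, 0 < t -> (F (2 * t)%R <= c%:E * F t)%E.

(* Only the values of [Phi] on [0, +oo[ matter here and below. Increasing
   functions are not required to be strictly increasing. *)
Definition condition_C Phi : Prop :=
  [/\ {within `[0, +oo[, continuous Phi},
      {in `[0, +oo[ &, {homo Phi : s t / s <= t}},
      Phi 0 = 0 &
      delta2 (EFin \o Phi)].

Definition young_function Phi : Prop :=
  [/\ condition_C Phi,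
      convex_function (`[0, +oo[%classic : set R) Phi &
      Phi t @[t --> +oo] --> +oo].

(* Extended-real valued: it may be infinite if [Phi] grows only linearly. *)
Definition conjugate Phi (t : R) : \bar R :=
  ereal_sup [set (s * t - Phi s)%:E | s in `]0, +oo[%classic].

Definition young_inv Phi : R -> R := pinv (`[0, +oo[%classic : set R) Phi.

(* For a Young function and 0 < s < 1 the set is bounded by 1 / s, because the
   inverse of a Young function is concave, so that the real [sup] is the genuine
   supremum. *)
Definition index_fun Phi (s : R) : R :=
  sup [set young_inv Phi t / young_inv Phi (s * t) | t in `]0, +oo[%classic].

(* [lim] is 0 when the limit does not exist, so that [0 < upper_index Phi]
   entails its existence. *)
Definition upper_index Phi : R :=
  lim ((fun s => - (ln (index_fun Phi s) / ln s)) @ 0^'+).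

End young.

Section weights.
Context {R : realType} (n : nat).
Local Open Scope ereal_scope.
Notation leb := (@lebesgueRn R n).
Implicit Types (w : 'rV[R]_n -> R) (A : set 'rV[R]_n).

Definition weight w : Prop :=
  [/\ measurable_fun setT w,
      forall x, (0 <= w x)%R,
      {ae leb, forall x, (0 < w x)%R} &
      forall x l, (0 < l)%R -> \int[leb]_(y in cube x l) (w y)%:E < +oo].

Definition average A (g : 'rV[R]_n -> R) : \bar R :=
  (leb A)^-1 * \int[leb]_(y in A) (g y)%:E.

(* [powR 0] of a negative exponent is 0, but [w > 0] almost everywhere. *)
Definition muckenhoupt (p : R) w : Prop :=
  weight w /\
  exists C : R, forall x l, (0 < l)%R ->
    average (cube x l) w *
      (average (cube x l) (fun y => w y `^ (- (p - 1)^-1))%R) `^ (p - 1)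
    <= C%:E.

End weights.

Section orlicz_morrey.
Context {R : realType} (n : nat).
Local Open Scope ereal_scope.
Notation leb := (@lebesgueRn R n).
Implicit Types (Phi : R -> R) (w f : 'rV[R]_n -> R) (A : set 'rV[R]_n)
  (phi : 'rV[R]_n -> R -> R).

Definition wmeasure w A : \bar R := \int[leb]_(y in A) (w y)%:E.

Definition modular Phi w A f : \bar R :=
  \int[leb]_(y in A) (Phi `|f y| * w y)%:E.

Definition orlicz_space Phi w : set ('rV[R]_n -> R) :=
  [set f : 'rV[R]_n -> R | measurable_fun setT f /\
    exists2 lam : R, (0 < lam)%R &
      modular Phi w setT (fun y => f y / lam)%R < +oo].

Definition orlicz_norm Phi w A f : \bar R :=
  ereal_inf [set lam%:E | lam in [set lam : R | (0 < lam)%R /\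
    (wmeasure w A)^-1 * \int[leb]_(y in A) (Phi (`|f y| / lam) * w y)%:E <= 1]].

Definition morrey_norm Phi phi w f : \bar R :=
  ereal_sup [set (phi Q.1 Q.2)%:E * orlicz_norm Phi w (cube Q.1 Q.2) f |
    Q in [set Q : 'rV[R]_n * R | (0 < Q.2)%R]].

Definition morrey_function phi : Prop :=
  [/\ {within [set z : 'rV[R]_n * R | (0 < z.2)%R],
        continuous (fun z => phi z.1 z.2)},
      forall x, {in `[0%R, +oo[ &, {homo phi x : s t / (s <= t)%R}} &
      forall x, phi x 0%R = 0%R].

End orlicz_morrey.

(* [D] is the domain of [S], a vector space of measurable functions; the values
   of [S] outside [D] are irrelevant. *)
Definition sublinear_operator (R : realType) (n : nat)
    (D : set ('rV[R]_n -> R)) (S : ('rV[R]_n -> R) -> ('rV[R]_n -> R)) : Prop :=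
  [/\ D `<=` [set f : 'rV[R]_n -> R | measurable_fun setT f],
      [/\ D (cst 0),
          forall f g, D f -> D g -> D (fun x => f x + g x) &
          forall (a : R) f, D f -> D (fun x => a * f x)],
      forall f : 'rV[R]_n -> R, D f -> measurable_fun setT (S f),
      forall f g, D f -> D g -> {ae @lebesgueRn R n, forall x,
        `|S (fun y => f y + g y) x| <= `|S f x| + `|S g x|} &
      forall (a : R) f, D f -> {ae @lebesgueRn R n, forall x,
        `|S (fun y => a * f y) x| = `|a| * `|S f x|}].

(* Main.v *)
Require Import Defs.
From HB Require Import structures.
From mathcomp Require Import all_boot all_order all_algebra.
From mathcomp Require Import all_classical all_reals all_analysis.
From mathcomp Require Import measurable_realfun.
From mathcomp Require Import ring lra.

Set Implicit Arguments.
Unset Strict Implicit.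
Unset Printing Implicit Defensive.

Import Order.TTheory GRing.Theory Num.Theory.
Import numFieldNormedType.Exports.

Local Open Scope classical_set_scope.
Local Open Scope ring_scope.

(** Fix a cube Q of centre z and side l, let 4Q be the concentric cube of side
    4 l, and split f into its restriction f1 to 4Q and the rest f2. The modular
    inequality for S and the doubling property of w bound the norm of S f1 on Q
    by the norm of f on 4Q. On Q the kernel bound for S f2 is at most a sum of
    averages of |f| over the cubes of side 2^j l with centre z. Such an average
    is at most a constant times the norm of f on a cube of twice the side
    ([average_le_orlicz]), hence at most a constant times the Morrey norm of f
    divided by phi(z, 2^(j+1) l). As phi is increasing, the sum of these
    quotients is controlled by the integral of 1/(t phi(z, t)) over
    [l, +oo[ ([dyadic_sum_le_integral]), and the hypothesis on phi and psi
    concludes. The two bounds, one in norm and one pointwise, are added up by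
    convexity of Phi ([orlicz_norm_sum]).

    The heart of the matter is the bound for averages. The index being 1/p only
    gives Phi(s) >= c s^q for large s and every q < p ([young_growth]), so that
    w in A_p does not suffice as it stands: one needs w in A_q for some q < p.
    This is the openness of the A_p condition, that is, a reverse Hoelder
    inequality for the dual weight sigma = w^(-1/(p-1)). It is obtained from the
    A_infinity property of sigma ([dual_weight_Ainfty]) by stopping cubes: the
    union of the dyadic cubes on which the average of sigma exceeds a height
    loses a fixed proportion of its sigma-mass when the height is multiplied by
    a fixed constant ([stop_decay]), whence a geometric decay of the
    distribution of sigma and some extra integrability ([reverse_hoelder]).
    That sigma is, up to null sets, small outside of the stopping cubes is a
    differentiation theorem ([density_outside]). For it, any measurable set is
    approximated in measure by finite unions of dyadic cubes; this makes sense
    in every measure space with a tree of cells. *)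

(** * Growth of Young functions *)

Section young_growth.
Context {R : realType} (Phi : R -> R).
Hypothesis young : young_function Phi.
Implicit Types s t q : R.

Let PhiC : condition_C Phi. Proof. by case: young. Qed.

Lemma young_homo s t : 0 <= s -> s <= t -> Phi s <= Phi t.
Proof.
move=> s0 st; case: PhiC => _ + _ _; apply => //; rewrite in_itv/= andbT//.
exact: le_trans st.
Qed.

Lemma young0 : Phi 0 = 0. Proof. by case: PhiC. Qed.

Lemma young_ge0 s : 0 <= s -> 0 <= Phi s.
Proof. by move=> s0; rewrite -young0 young_homo. Qed.

Lemma measurable_young d (T : measurableType d) (f : T -> R) :
  measurable_fun setT f -> (forall x, 0 <= f x) ->
  measurable_fun setT (fun x => Phi (f x)).
Proof.
move=> mf f0; case: PhiC => cts _ _ _.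
have mI : measurable (`[0, +oo[%classic : set R) by [].
apply: (measurable_comp mI) mf.
  by move=> _ [x _ <-] /=; rewrite in_itv/= f0.
exact: subspace_continuous_measurable_fun.
Qed.

Lemma young_convex (a s t : R) : 0 <= a <= 1 -> 0 <= s -> 0 <= t ->
  Phi (a * s + (1 - a) * t) <= a * Phi s + (1 - a) * Phi t.
Proof.
move=> a01 s0 t0; case: young => _ cvx _.
have := cvx (Itv01 (andP a01).1 (andP a01).2) s t.
rewrite !inE/= !in_itv/= s0 t0 => /(_ isT isT).
by rewrite !convRE.
Qed.

Lemma young_scale (a s : R) : 0 <= a <= 1 -> 0 <= s -> Phi (a * s) <= a * Phi s.
Proof.
move=> a01 s0; have := young_convex a01 s0 (lexx 0).
by rewrite young0 !mulr0 !addr0.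
Qed.

(** By the doubling condition a zero of Phi at some t > 0 would propagate to
    all 2^k t, whereas Phi tends to infinity. *)
Lemma young_gt0 t : 0 < t -> 0 < Phi t.
Proof.
move=> t0; rewrite lt_neqAle young_ge0 ?ltW// andbT eq_sym; apply/negP => /eqP Pt.
have [_ _ _ [c hc]] := PhiC.
have P2 k : Phi (2 ^+ k * t) = 0.
  elim: k => [|k ih]; first by rewrite expr0 mul1r.
  have tk : 0 < 2 ^+ k * t by rewrite mulr_gt0// exprn_gt0.
  have := hc _ tk; rewrite /= ih mule0 lee_fin mulrA -exprS => h.
  by apply/eqP; rewrite eq_le h young_ge0// mulr_ge0// ltW.
case: young => _ _ /cvgryPge/(_ 1) [M [_ HM]].
pose k := (Num.truncn (`|M| / t)).+1.
have : M < 2 ^+ k * t.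
  rewrite (le_lt_trans (ler_norm M))// -ltr_pdivrMr//.
  rewrite (lt_le_trans (truncnS_gt _))//.
  by rewrite -natrX ler_nat ltnW// ltn_expl.
by move/HM; rewrite P2 ler10.
Qed.

Lemma young_lt s t : 0 <= s -> s < t -> Phi s < Phi t.
Proof.
move=> s0 st; have t0 : 0 < t by exact: le_lt_trans st.
have st1 : 0 <= s / t <= 1.
  by rewrite divr_ge0 ?(ltW t0)//= ler_pdivrMr// mul1r ltW.
have := young_scale st1 (ltW t0); rewrite divfK ?gt_eqF// => /le_lt_trans; apply.
by rewrite gtr_pMl ?young_gt0// ltr_pdivrMr// mul1r.
Qed.

Lemma young_surj t : 0 <= t -> exists2 s, 0 <= s & Phi s = t.
Proof.
move=> t0; case: young => -[cts _ _ _] _ /cvgryPge/(_ t) [M [_ HM]].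
have M0 : 0 <= `|M| + 1 by rewrite addr_ge0.
have tM : t <= Phi (`|M| + 1).
  by apply: HM; rewrite (le_lt_trans (ler_norm M))// ltrDl.
have cts' : {within `[0, `|M| + 1], continuous Phi}.
  by apply: continuous_subspaceW cts => x /=; rewrite !in_itv/= => /andP[->].
have [|s] := IVT M0 cts' (v := t).
  rewrite young0 (min_idPl _) ?young_ge0// (max_idPr _) ?young_ge0//.
  by rewrite t0 tM.
by rewrite in_itv/= => /andP[s0 _] <-; exists s.
Qed.

Lemma young_inv_cancel s : 0 <= s -> young_inv Phi (Phi s) = s.
Proof.
move=> s0; apply: pinvKV; last by rewrite inE/= in_itv/= s0.
move=> a b; rewrite !inE/= !in_itv/= !andbT => a0 b0 ab.
by have [/(young_lt a0)|/(young_lt b0)|//] := ltgtP a b; rewrite ab ltxx.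
Qed.

(** The inverse of Phi is concave, so that s^-1 bounds the ratios of which
    [index_fun] takes the supremum, and the latter is an upper bound. *)
Lemma index_fun_ge s t : 0 < s < 1 -> 0 < t ->
  young_inv Phi t / young_inv Phi (s * t) <= index_fun Phi s.
Proof.
move=> /andP[s0 s1] t0; apply: ub_le_sup; last by exists t; rewrite //= in_itv/= t0.
exists s^-1 => x [u/=]; rewrite in_itv/= andbT => u0 <-{x}.
have [b b0 Pb] := young_surj (ltW u0).
have [a a0 Pa] : exists2 a, 0 <= a & Phi a = s * u.
  by apply: young_surj; rewrite mulr_ge0// ltW.
rewrite -Pa -{1}Pb !young_inv_cancel//.
have {}a0 : 0 < a.
  rewrite lt_neqAle a0 andbT; apply/eqP => a00.
  by move: Pa; rewrite -a00 young0 => /esym/eqP; rewrite mulf_eq0 !gt_eqF.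
rewrite ler_pdivrMr// mulrC -ler_pdivrMr ?invr_gt0// invrK mulrC leNgt.
apply/negP => /(young_lt (ltW a0)); rewrite Pa -Pb ltNge young_scale//.
by rewrite !ltW.
Qed.

(** Put t = Phi s and the dilation Phi 1 / Phi s in the ratios that define the
    index: the ratio is s, and as q^-1 exceeds the index it is at most
    (Phi s / Phi 1)^(1/q) once the dilation is small. The other s are bounded. *)
Lemma young_growth p q : 0 < upper_index Phi -> upper_index Phi = p^-1 ->
  0 < q < p -> exists2 K, 0 < K & forall s, 0 <= s -> s `^ q <= K * (1 + Phi s).
Proof.
move=> u0 up /andP[q0 qp].
have P1 : 0 < Phi 1 by exact: young_gt0.
have p0 : 0 < p by exact: lt_trans qp.
set F := (fun s => - (ln (index_fun Phi s) / ln s)) @ 0^'+.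
have cF : cvg F.
  apply: contrapT => /dvgP h; move: u0; rewrite /upper_index h.
  by rewrite ltxx.
have Fq : F --> p^-1 by rewrite -up.
have : \forall s \near 0^'+, - (ln (index_fun Phi s) / ln s) < q^-1.
  by apply: (cvgr_lt _ Fq); rewrite ltf_pV2.
move=> [d /= d0 hd].
(* a dilation smaller than e is in the range of hd and smaller than 1 *)
pose e := Num.min d 1 / 2.
have e0 : 0 < e by rewrite divr_gt0// lt_min d0 ltr01.
have e1 : e < 1.
  by rewrite ltr_pdivrMr// mul1r gt_min (_ : 1 < 2) ?orbT// ltr1n.
have ed : e < d.
  rewrite ltr_pdivrMr// gt_min ltr_pMr// (_ : 1 < 2) ?ltr1n//.
have key s : 1 <= s -> Phi 1 < e * Phi s -> s `^ q <= Phi s / Phi 1.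
  move=> s1 es; have s0 : 0 < s by exact: lt_le_trans s1.
  have Ps : 0 < Phi s by exact: young_gt0.
  set g := Phi 1 / Phi s.
  have g0 : 0 < g by rewrite divr_gt0.
  have ge : g < e by rewrite ltr_pdivrMr.
  have g1 : g < 1 by exact: lt_trans e1.
  have lng : ln g < 0 by rewrite ln_lt0// g0.
  have := hd g; rewrite /= sub0r normrN gtr0_norm// => /(_ (lt_trans ge ed) g0).
  rewrite -mulNr ltr_ndivrMr// ltrNr => lnh.
  have := @index_fun_ge g (Phi s); rewrite g0 g1 => /(_ isT Ps).
  rewrite /g divfK ?gt_eqF// !young_inv_cancel ?ler01 ?(ltW s0)// divr1 => sh.
  have : ln s < - (q^-1 * ln g).
    by apply: le_lt_trans lnh; rewrite ler_ln// posrE// (lt_le_trans s0).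
  rewrite -mulrN -lnV ?posrE// invf_div -ltr_pdivrMl ?invr_gt0// invrK => /ltW h.
  by rewrite -[leRHS]lnK ?posrE ?divr_gt0// /powR gt_eqF// ler_expR.
exists (Num.max (Phi 1)^-1 (e^-1 `^ q)).
  by rewrite lt_max invr_gt0 P1.
move=> s s0; have Ps0 := young_ge0 s0.
have [h|h] := ltP (Phi 1) (e * Phi s).
  rewrite (le_trans (key s _ h))//.
    rewrite leNgt; apply/negP => s1; move: h; apply/negP; rewrite -leNgt.
    rewrite (@le_trans _ _ (Phi s)) ?ler_piMl ?(ltW e1)//.
    by rewrite young_homo// ltW.
  rewrite mulrC ler_pM ?invr_ge0 ?(ltW P1)//; first by rewrite le_max lexx.
  by rewrite lerDr.
have se : s <= e^-1.
  rewrite leNgt; apply/negP => es; move: h; apply/negP; rewrite -ltNge.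
  have s0' : 0 < s by rewrite (lt_trans _ es)// invr_gt0.
  have ss1 : 0 <= s^-1 <= 1.
    rewrite invr_ge0 s0 invf_le1// ltW// (lt_trans _ es)// invf_gt1//.
  have := young_scale ss1 s0; rewrite mulVf ?gt_eqF// => /le_lt_trans; apply.
  by rewrite ltr_pM2r ?young_gt0// -[ltRHS]invrK ltf_pV2// posrE// invr_gt0.
rewrite -[leLHS]mulr1 ler_pM ?powR_ge0//; last by rewrite lerDl.
rewrite le_max ge0_ler_powR ?orbT// ?nnegrE ?invr_ge0// ltW//.
Qed.

End young_growth.
(** * Monotone sequences of sets *)

Section measure_lemmas.
Context d (T : measurableType d) (R : realType) (mu : {measure set T -> \bar R}).
Local Open Scope ereal_scope.

Lemma measure_bigcup_le (F : (set T)^nat) (C : \bar R) :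
  (forall n, measurable (F n)) -> (forall n, F n `<=` F n.+1) ->
  (forall n, mu (F n) <= C) -> mu (\bigcup_n F n) <= C.
Proof.
move=> mF ndF FC.
have /cvg_lim <- // : mu \o F @ \oo --> mu (\bigcup_n F n).
  apply: nondecreasing_cvg_mu => //; first exact: bigcupT_measurable.
  by apply/nondecreasing_seqP => n; apply/subsetPset.
apply: lime_le; last by apply: nearW.
apply/cvg_ex; exists (mu (\bigcup_n F n)).
apply: nondecreasing_cvg_mu => //; first exact: bigcupT_measurable.
by apply/nondecreasing_seqP => n; apply/subsetPset.
Qed.

Lemma measure_bigcap_ge (F : (set T)^nat) (C : \bar R) :
  (forall n, measurable (F n)) -> (forall n, F n.+1 `<=` F n) ->
  mu (F 0%N) < +oo ->
  (forall n, C <= mu (F n)) -> C <= mu (\bigcap_n F n).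
Proof.
move=> mF niF Foo FC.
have cvgF : mu \o F @ \oo --> mu (\bigcap_n F n).
  apply: nonincreasing_cvg_mu => //; first exact: bigcapT_measurable.
  by apply/nonincreasing_seqP => n; apply/subsetPset.
have /cvg_lim <- // := cvgF.
apply: lime_ge; last by apply: nearW.
by apply/cvg_ex; exists (mu (\bigcap_n F n)).
Qed.

Lemma measure_bigcap0_lt (F : (set T)^nat) (e : R) :
  (forall n, measurable (F n)) -> (forall n, F n.+1 `<=` F n) ->
  mu (F 0%N) < +oo -> \bigcap_n F n = set0 -> (0 < e)%R ->
  exists n, mu (F n) < e%:E.
Proof.
move=> mF niF Foo F0 e0; apply: contrapT => h.
have : e%:E <= mu (\bigcap_n F n).
  apply: measure_bigcap_ge => // n; rewrite leNgt; apply/negP => h'.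
  by apply: h; exists n.
by rewrite F0 measure0 lee_fin leNgt e0.
Qed.

End measure_lemmas.

(** * Differentiation along a tree of cells *)

Section cells.
Context d (T : measurableType d) (R : realType) (X : Type) (J : finType).
Variables (cell : X -> set T) (child : X -> J -> X).
Hypothesis mcell : forall c, measurable (cell c).
Hypothesis cellE : forall c, cell c = \bigcup_j cell (child c j).
Hypothesis cellD : forall c j k x,
  cell (child c j) x -> cell (child c k) x -> j = k.
Local Open Scope ereal_scope.
Implicit Types (c : X) (A B E P : set T) (N M : nat) (t a : R).
Implicit Types (mu nu m : {measure set T -> \bar R}).

Let childS c j : cell (child c j) `<=` cell c.
Proof. by move=> x cx; rewrite cellE; exists j. Qed.

Let child_le mu nu (a b : R) (A B : J -> set T) c : (0 <= a)%R -> (0 <= b)%R ->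
  (forall j, measurable (A j)) -> (forall j, A j `<=` cell (child c j)) ->
  (forall j, measurable (B j)) -> (forall j, B j `<=` cell (child c j)) ->
  (forall j, a%:E * mu (A j) <= b%:E * nu (B j)) ->
  a%:E * mu (\bigcup_j A j) <= b%:E * nu (\bigcup_j B j).
Proof.
move=> a0 b0 mA AS mB BS AB.
have triv F : (forall j, F j `<=` cell (child c j)) -> trivIset setT F.
  by move=> FS i j _ _ [x [/FS xi /FS xj]]; exact: cellD xi xj.
have sumE m F : (forall j, measurable (F j)) ->
    (forall j, F j `<=` cell (child c j)) ->
    m (\bigcup_j F j) = \sum_(j \in [set: J]) m (F j).
  move=> mF FS; apply: measure_fin_bigcup => //; first exact: finite_finset.
  exact: triv.
rewrite !sumE// !ge0_mule_fsumr//.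
by apply: lee_fsum => [|j _]; [exact: finite_finset|exact: AB].
Qed.

Fixpoint same_cell N c (x y : T) : Prop :=
  if N is N'.+1 then exists j, same_cell N' (child c j) x y
  else cell c x /\ cell c y.

Lemma same_cell_sub N c x y : same_cell N c x y -> cell c x /\ cell c y.
Proof.
elim: N c => // N ih c [j /ih[cx cy]].
by split; exact: (@childS c j).
Qed.

Lemma same_cell_sym N c x y : same_cell N c x y -> same_cell N c y x.
Proof. by elim: N c => [c []|N ih c [j /ih h]] //; exists j. Qed.

Lemma same_cell_refl N c x : cell c x -> same_cell N c x x.
Proof.
elim: N c => [//|N ih] c; rewrite cellE => -[j _ /ih h].
by exists j.
Qed.

Lemma same_cell_trans N c x y z :
  same_cell N c x y -> same_cell N c y z -> same_cell N c x z.
Proof.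
elim: N c => [c [? _] [_ ?] //|N ih c [j xy] [k yz]].
have [_ yj] := same_cell_sub xy; have [yk _] := same_cell_sub yz.
by rewrite (cellD yk yj) in yz; exists j; exact: ih yz.
Qed.

Lemma same_cellW N M c x y : (N <= M)%N ->
  same_cell M c x y -> same_cell N c x y.
Proof.
elim: M N c => [[]//|M ih [|N] c NM h]; first exact: same_cell_sub h.
by case: h => j h; exists j; exact: ih h.
Qed.

(** The traces of these sets on the root cell are the unions of cells of
    generation N. Stated with an equivalence relation, their stability under
    Boolean operations is immediate. *)
Definition saturated N c B :=
  forall x y, same_cell N c x y -> B x -> B y.

Lemma saturatedW N M c B : (N <= M)%N -> saturated N c B -> saturated M c B.
Proof. by move=> NM h x y /(same_cellW NM); exact: h. Qed.

Lemma saturatedC N c B : saturated N c B -> saturated N c (~` B).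
Proof. by move=> h x y /same_cell_sym yx Bx By; exact/Bx/(h _ _ yx). Qed.

Lemma saturatedU N c A B :
  saturated N c A -> saturated N c B -> saturated N c (A `|` B).
Proof.
by move=> hA hB x y xy [/(hA _ _ xy)|/(hB _ _ xy)] h; [left|right].
Qed.

Lemma saturated_child N c B j :
  saturated N.+1 c B -> saturated N (child c j) B.
Proof. by move=> h x y xy; apply: h; exists j. Qed.

Lemma saturated0P c B : saturated 0 c B ->
  cell c `&` B = cell c \/ cell c `&` B = set0.
Proof.
move=> h; have [[x [cx Bx]]|n] := pselect (cell c `&` B !=set0); [left|right].
  by apply/setIidPl => y cy; apply: (h x).
by apply/seteqP; split => // x cBx; apply: n; exists x.
Qed.

Let setI_children c B : cell c `&` B = \bigcup_j (cell (child c j) `&` B).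
Proof. by rewrite {1}cellE setI_bigcupl. Qed.

Lemma measurable_saturated N c B : saturated N c B -> measurable (cell c `&` B).
Proof.
elim: N c => [c /saturated0P[]-> //|N ih c h].
rewrite setI_children; apply: fin_bigcup_measurable => // j _.
exact: ih (saturated_child h).
Qed.

Section approximation.
Variables (m : {measure set T -> \bar R}) (c : X).
Hypothesis moo : m (cell c) < +oo.

Definition approximable A := measurable A /\
  forall e : R, (0 < e)%R ->
    exists N, exists2 B, saturated N c B & m (cell c `&` (A `+` B)) < e%:E.

Let msetY A N B : measurable A -> saturated N c B ->
  measurable (cell c `&` (A `+` B)).
Proof.
move=> mA sB; have mB := measurable_saturated sB.
have mB' := measurable_saturated (saturatedC sB).
rewrite (_ : _ `&` _ =
    (A `&` (cell c `&` ~` B)) `|` ((cell c `&` B) `&` ~` A)); last first.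
  by apply/seteqP; split=> x /=; tauto.
by apply: measurableU; apply: measurableI => //; exact: measurableC.
Qed.

Let approxU A1 A2 : approximable A1 -> approximable A2 -> approximable (A1 `|` A2).
Proof.
move=> [mA1 h1] [mA2 h2]; split; first exact: measurableU.
move=> e e0; have e20 : (0 < e / 2)%R by rewrite divr_gt0.
have [N1 [B1 s1 d1]] := h1 _ e20; have [N2 [B2 s2 d2]] := h2 _ e20.
have s1' := saturatedW (leq_maxl N1 N2) s1.
have s2' := saturatedW (leq_maxr N1 N2) s2.
exists (maxn N1 N2), (B1 `|` B2); first exact: saturatedU.
have m1 := msetY mA1 s1; have m2 := msetY mA2 s2.
apply: (@le_lt_trans _ _ (m (cell c `&` (A1 `+` B1) `|` cell c `&` (A2 `+` B2)))).
  apply: le_measure; rewrite ?inE; [|exact: measurableU|].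
    by apply: msetY; [exact: measurableU|exact: saturatedU s2'].
  move=> x [cx]; case=> -[[]h /not_orP[n1 n2]].
  - by left; split => //; left.
  - by right; split => //; left.
  - by left; split => //; right.
  - by right; split => //; right.
apply: le_lt_trans (measureU2 _ _ _) _ => //.
by rewrite [e]splitr EFinD lteD.
Qed.

(** A countable union is approximated by a finite one because the measure of
    the root cell is finite. *)
Lemma sigma_algebra_approximable : sigma_algebra setT approximable.
Proof.
have approx0 : approximable set0.
  split=> // e e0; exists 0%N, set0 => //.
  by rewrite setYK setI0 measure0 lte_fin.
split => //.
- move=> A [mA h]; rewrite setTD; split; first exact: measurableC.
  move=> e e0; have [N [B sB dB]] := h e e0; exists N, (~` B).
    exact: saturatedC.
  rewrite (_ : ~` A `+` ~` B = A `+` B)//; apply/seteqP.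
  by split=> x /=; case: (pselect (A x)); case: (pselect (B x)); tauto.
- move=> A hA; set U := \bigcup_k A k.
  have mA k : measurable (A k) by case: (hA k).
  have mU : measurable U by exact: bigcupT_measurable.
  split=> // e e0; have e20 : (0 < e / 2)%R by rewrite divr_gt0.
  pose V n := \big[setU/set0]_(i < n) A i.
  have aV n : approximable (V n).
    by rewrite /V; elim/big_ind : _ => // *; exact: approxU.
  have mV n : measurable (V n) by case: (aV n).
  have VU n : V n `<=` U.
    by move=> x; rewrite /V -bigcup_mkord => -[k _ Ak]; exists k.
  have [||||n hn] := @measure_bigcap0_lt _ _ _ m (fun n => cell c `&` (U `\` V n))
      _ _ _ _ _ e20.
  - by move=> n; apply: measurableI => //; exact: measurableD.
  - move=> n x [cx [Ux nV]]; split=> //; split=> // Vx; apply: nV.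
    by rewrite /V big_ord_recr; left.
  - apply: le_lt_trans moo; apply: le_measure; rewrite ?inE//.
    by apply: measurableI => //; exact: measurableD.
  - apply/seteqP; split => // x h; have [_ [[k _ Ak] _]] := h 0%N I.
    have [_ [_]] := h k.+1 I; apply.
    by rewrite /V -bigcup_mkord; exists k => /=.
  have [_ /(_ _ e20)[N [B sB dB]]] := aV n.
  exists N, B => //.
  have m1 : measurable (cell c `&` (U `\` V n)).
    by apply: measurableI => //; exact: measurableD.
  have m2 := msetY (mV n) sB.
  apply: (@le_lt_trans _ _
      (m (cell c `&` (U `\` V n) `|` cell c `&` (V n `+` B)))).
    apply: le_measure; rewrite ?inE; [exact: msetY sB|exact: measurableU|].
    move=> x [cx [[Ux nB]|[Bx nU]]].
      have [Vx|nV] := pselect (V n x); first by right; split=> //; left.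
      by left.
    by right; split=> //; right; split=> // /VU.
  apply: le_lt_trans (measureU2 _ _ _) _ => //.
  by rewrite [e]splitr EFinD lteD.
Qed.

(** On the root cell such a set, for instance an open set of a Euclidean space,
    is the increasing union of saturated sets: those of the points whose cell
    of generation N it contains. *)
Lemma approximable_open P : measurable P ->
  (forall x, cell c x -> P x -> exists N, forall y, same_cell N c x y -> P y) ->
  approximable P.
Proof.
move=> mP openP; split=> // e e0.
pose U N := [set x | cell c x /\ forall y, same_cell N c x y -> P y].
have sU N : saturated N c (U N).
  move=> x y xy [cx hx]; split; first by have [] := same_cell_sub xy.
  by move=> z yz; apply: hx; exact: same_cell_trans yz.
have UP N : U N `<=` P by move=> x [cx]; apply; exact: same_cell_refl.
have mYU N := msetY mP (sU N).
have [||||n hn] := @measure_bigcap0_lt _ _ _ m (fun n => cell c `&` (P `+` U n))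
    _ _ _ _ _ e0; last by exists n, (U n).
- by move=> n; exact: mYU.
- move=> n x [cx [[Px nU]|[/UP Px nP]//]]; split=> //; left; split=> // -[_ h].
  by apply: nU; split=> // y; move/(same_cellW (leqnSn n)); exact: h.
- by apply: le_lt_trans moo; apply: le_measure; rewrite ?inE//.
- apply/seteqP; split => // x h; have [cx hx] := h 0%N I.
  have Px : P x by case: hx => [[]//|[/UP]].
  have [N hN] := openP _ cx Px.
  by have [_ [[_]|[/UP]//]] := h N I; apply.
Qed.

End approximation.

Section stopping.
Variables mu nu : {measure set T -> \bar R}.
Hypothesis muoo : forall c, mu (cell c) < +oo.

(** The union of the maximal cells, up to generation N, on which the
    average density of nu with respect to mu exceeds t. *)
Fixpoint stop t N c : set T :=
  if t%:E * mu (cell c) < nu (cell c) then cell c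
  else if N is N'.+1 then \bigcup_j stop t N' (child c j) else set0.

Definition stopping t c := \bigcup_N stop t N c.

Lemma stop_sub t N c : stop t N c `<=` cell c.
Proof.
elim: N c => [|N ih] c x /=; case: ifPn => _ //.
by move=> [j _ /ih]; exact: childS.
Qed.

Lemma stopping_sub t c : stopping t c `<=` cell c.
Proof. by move=> x [N _]; exact: stop_sub. Qed.

Lemma measurable_stop t N c : measurable (stop t N c).
Proof.
elim: N c => [|N ih] c /=; case: ifPn => // _.
by apply: fin_bigcup_measurable => [|j _]; [exact: finite_finset|exact: ih].
Qed.

Lemma measurable_stopping t c : measurable (stopping t c).
Proof. by apply: bigcupT_measurable => N; exact: measurable_stop. Qed.

Lemma stopS t N c : stop t N c `<=` stop t N.+1 c.
Proof.
elim: N c => [|N ih] c x; first by rewrite /=; case: ifPn => _ //.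
rewrite [stop t N.+1 c]/= [stop t N.+2 c]/=; case: ifPn => // _ [j _ /ih h].
by exists j.
Qed.

Lemma stop_mono t N M c : (N <= M)%N -> stop t N c `<=` stop t M c.
Proof.
move=> /subnK <-; elim: (M - N)%N => [//|k ih] x /ih; exact: stopS.
Qed.

Lemma stop_density t N c : (0 <= t)%R ->
  t%:E * mu (stop t N c) <= nu (stop t N c).
Proof.
move=> t0; elim: N c => [|N ih] c /=; case: ifPn => h; rewrite ?measure0 ?mule0//.
- exact: ltW.
- exact: ltW.
rewrite -[leRHS]mul1e; apply: (@child_le mu nu t 1%R _ _ c) => // j.
- exact: measurable_stop.
- exact: stop_sub.
- exact: measurable_stop.
- exact: stop_sub.
- by rewrite mul1e.
Qed.

(** The cells of generation N that meet the complement of the stopping set are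
    those that no stopping cell contains, so their averages are at most t. *)
Lemma saturated_density t N c B : (0 <= t)%R -> saturated N c B ->
  nu ((cell c `&` B) `\` stop t N c) <= t%:E * mu ((cell c `&` B) `\` stop t N c).
Proof.
move=> t0; elim: N c => [|N ih] c sB /=; case: ifPn => h.
- by rewrite (_ : _ `\` _ = set0) ?measure0 ?mule0//; apply/seteqP;
    split=> // x [[]].
- rewrite setD0; have [->|->] := saturated0P sB; last by rewrite !measure0 mule0.
  by rewrite leNgt.
- by rewrite (_ : _ `\` _ = set0) ?measure0 ?mule0//; apply/seteqP;
    split=> // x [[]].
have -> : (cell c `&` B) `\` (\bigcup_j stop t N (child c j)) =
    \bigcup_j ((cell (child c j) `&` B) `\` stop t N (child c j)).
  apply/seteqP; split=> x.
    rewrite cellE => -[[[j _ cj] Bx] nS]; exists j => //; split=> // Sx.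
    by apply: nS; exists j.
  move=> [j _ [[cj Bx] nS]]; split; first by split=> //; exact: childS cj.
  move=> [k _ Sx]; apply: nS.
  by rewrite (cellD cj (stop_sub Sx)).
rewrite -[leLHS]mul1e.
have mD j : measurable ((cell (child c j) `&` B) `\` stop t N (child c j)).
  apply: measurableD; last exact: measurable_stop.
  exact: measurable_saturated (saturated_child sB).
apply: (@child_le nu mu 1%R t _ _ c) => // [j x [[]//]|j x [[]//]|j].
by rewrite mul1e; exact: ih (saturated_child sB).
Qed.

(** Let the generation tend to infinity: the sets that avoid the stopping cells
    of the first generations decrease. *)
Lemma saturated_density_stopping t N c B : (0 < t)%R -> saturated N c B ->
  nu ((cell c `&` B) `\` stopping t c) <=
  t%:E * mu ((cell c `&` B) `\` stopping t c).
Proof.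
move=> t0 sB; have mB := measurable_saturated sB.
have mS k : measurable ((cell c `&` B) `\` stop t k c).
  by apply: measurableD => //; exact: measurable_stop.
have mSoo : measurable ((cell c `&` B) `\` stopping t c).
  by apply: measurableD => //; exact: measurable_stopping.
rewrite -lee_pdivrMl// [in leRHS]/stopping -bigcupDr; last by exists 0%N.
apply: measure_bigcap_ge => //.
- by move=> n x [cBx nS]; split=> // /stopS.
- apply: le_lt_trans (muoo c); apply: le_measure; rewrite ?inE//.
  by move=> x [[]].
move=> n; rewrite lee_pdivrMl//; set M := maxn n N.
have sBM := saturatedW (leq_maxr n N) sB.
apply: (@le_trans _ _ (t%:E * mu ((cell c `&` B) `\` stop t M c))).
  apply: le_trans (saturated_density (ltW t0) sBM).
  apply: le_measure; rewrite ?inE//; first exact: bigcapT_measurable.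
  by move=> x h; exact: (h M I).
apply: lee_wpmul2l; first by rewrite lee_fin ltW.
apply: le_measure; rewrite ?inE// => x [cBx nS]; split=> // Sx; apply: nS.
exact: (stop_mono (leq_maxl n N)).
Qed.


(** A dyadic form of the differentiation theorem. Saturated sets inherit the
    bound from their cells, and E is approximated by saturated sets for mu and
    nu simultaneously. *)
Lemma density_outside t c E : (0 < t)%R -> E `<=` cell c `\` stopping t c ->
  approximable (measure_add mu nu) c E -> nu E <= t%:E * mu E.
Proof.
move=> t0 ES [mE aE]; apply/lee_addgt0Pr => e e0.
have t1 : (0 < t + 1)%R by rewrite addr_gt0.
have [N [B sB]] := aE (e / (t + 1))%R (divr_gt0 e0 t1).
set F := (cell c `&` B) `\` stopping t c; set G := cell c `&` (E `+` B).
rewrite (_ : _ G = mu G + nu G); last exact: measure_addE.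
move=> dG.
have mB := measurable_saturated sB.
have mF : measurable F by apply: measurableD => //; exact: measurable_stopping.
have mG : measurable G.
  rewrite (_ : G = (cell c `&` E `\` (cell c `&` B)) `|` ((cell c `&` B) `\` E)).
    apply: measurableU; apply: measurableD => //; exact: measurableI.
  by apply/seteqP; split=> x; rewrite /G/=; tauto.
have muG : mu G <= (e / (t + 1))%:E.
  by apply: ltW; apply: le_lt_trans dG; rewrite leeDl.
have nuG : nu G <= (e / (t + 1))%:E.
  by apply: ltW; apply: le_lt_trans dG; rewrite leeDr.
have EFG : E `<=` F `|` G.
  move=> x Ex; have [cx nS] := ES _ Ex.
  have [Bx|nB] := pselect (B x); first by left.
  by right; split=> //; left.
have FEG : F `<=` E `|` G.
  move=> x [[cx Bx] nS]; have [Ex|nE] := pselect (E x); first by left.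
  by right; split=> //; right.
have nuE : nu E <= nu F + nu G.
  apply: le_trans (measureU2 _ _ _) => //.
  by apply: le_measure; rewrite ?inE//; exact: measurableU.
have muF : mu F <= mu E + mu G.
  apply: le_trans (measureU2 _ _ _) => //.
  by apply: le_measure; rewrite ?inE//; exact: measurableU.
apply: (le_trans nuE); apply: (@le_trans _ _ (t%:E * (mu E + mu G) + nu G)).
  apply: leeD => //; apply: le_trans (saturated_density_stopping t0 sB) _.
  by apply: lee_wpmul2l => //; rewrite lee_fin ltW.
rewrite ge0_muleDr// -addeA; apply: leeD => //.
apply: (@le_trans _ _ (t%:E * (e / (t + 1))%:E + (e / (t + 1))%:E)).
  by apply: leeD => //; apply: lee_wpmul2l => //; rewrite lee_fin ltW.
rewrite -EFinM -EFinD lee_fin -[X in (_ + X)%R]mul1r -mulrDl.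
by rewrite mulrC divfK// gt_eqF.
Qed.

Section doubling_cells.
Variables K b : R.
Hypothesis K1 : (1 <= K)%R.
Hypothesis muK : forall c j, mu (cell c) <= K%:E * mu (cell (child c j)).
Hypothesis nub : forall c E, measurable E -> E `<=` cell c ->
  2%:E * mu E <= mu (cell c) -> nu E <= b%:E * nu (cell c).

(** Inside a stopping cell for the height t the average is at most K t, so that
    the stopping set for the height 2 K t fills at most half of that cell. *)
Lemma stop_decay t N c : (0 < t)%R -> nu (cell c) <= (K * t)%:E * mu (cell c) ->
  (0 <= b)%R -> nu (stop (2 * K * t) N c) <= b%:E * nu (stop t N c).
Proof.
move=> t0 + b0.
have K0 : (0 < K)%R by exact: lt_le_trans K1.
have Kt0 : (0 < K * t)%R by rewrite mulr_gt0.
have tKt : (t <= 2 * K * t)%R.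
  by rewrite ler_peMl ?(ltW t0)// mulr_ege1// ler1n.
have half M c' : nu (cell c') <= (K * t)%:E * mu (cell c') ->
    nu (stop (2 * K * t) M c') <= b%:E * nu (cell c').
  move=> h; apply: nub; [exact: measurable_stop|exact: stop_sub|].
  rewrite -(@lee_pmul2l _ (K * t)%:E)// muleA -EFinM.
  rewrite mulrC mulrA; apply: le_trans h.
  apply: le_trans (stop_density _ _ _) _; first by rewrite -mulrA mulr_ge0// ltW.
  by apply: le_measure; rewrite ?inE//; [exact: measurable_stop|exact: stop_sub].
elim: N c => [|N ih] c h.
  rewrite [stop t 0 c]/=; case: ifPn => [_|]; first exact: half.
  rewrite -leNgt => ct /=; rewrite ifF ?measure0 ?mule0//; apply/negbTE.
  rewrite -leNgt; apply: le_trans ct _.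
  by apply: lee_wpmul2r => //; rewrite lee_fin.
rewrite [stop t N.+1 c]/=; case: ifPn => [_|]; first exact: half.
rewrite -leNgt => ct /=; rewrite ifF; last first.
  apply/negbTE; rewrite -leNgt; apply: le_trans ct _.
  by apply: lee_wpmul2r => //; rewrite lee_fin.
rewrite -[leLHS]mul1e.
apply: (@child_le nu nu 1%R b _ _ c) => // [j|j|j|j|j].
- exact: measurable_stop.
- exact: stop_sub.
- exact: measurable_stop.
- exact: stop_sub.
rewrite mul1e; apply: ih.
apply: (@le_trans _ _ (nu (cell c))).
  by apply: le_measure; rewrite ?inE//; exact: childS.
apply: (le_trans ct); rewrite mulrC EFinM -muleA.
by apply: lee_wpmul2l => //; rewrite lee_fin ltW.
Qed.

Lemma stopping_decay t c : (0 < t)%R ->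
  nu (cell c) <= (K * t)%:E * mu (cell c) -> (0 <= b)%R ->
  nu (stopping (2 * K * t) c) <= b%:E * nu (stopping t c).
Proof.
move=> t0 h b0; apply: measure_bigcup_le => [n|n|n].
- exact: measurable_stop.
- exact: stopS.
apply: le_trans (stop_decay _ t0 h b0) _.
apply: lee_wpmul2l; first by rewrite lee_fin.
apply: le_measure; rewrite ?inE; [exact: measurable_stop|
  exact: measurable_stopping|by move=> x; exists n].
Qed.

Lemma stopping_decayX t c j : (0 < t)%R ->
  nu (cell c) <= t%:E * mu (cell c) -> (0 <= b)%R ->
  nu (stopping (t * (2 * K) ^+ j) c) <= (b ^+ j)%:E * nu (cell c).
Proof.
move=> t0 h b0; have K0 : (0 < K)%R by exact: lt_le_trans K1.
have K21 : (1 <= 2 * K)%R by rewrite mulr_ege1// ler1n.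
elim: j => [|j ih].
  rewrite !expr0 mul1e mulr1; apply: le_measure; rewrite ?inE//.
    exact: measurable_stopping.
  exact: stopping_sub.
rewrite exprS mulrCA; apply: le_trans (stopping_decay _ _ b0) _.
- by rewrite mulr_gt0// exprn_gt0// mulr_gt0.
- apply: le_trans h _; apply: lee_wpmul2r => //; rewrite lee_fin mulrCA.
  by rewrite ler_peMr ?(ltW t0)// mulr_ege1// exprn_ege1.
- by rewrite exprS EFinM -muleA; apply: lee_wpmul2l; rewrite ?lee_fin.
Qed.

End doubling_cells.
End stopping.
End cells.
(** * The reverse Hoelder inequality *)

Section reverse_hoelder.
Context d (T : measurableType d) (R : realType) (X : Type) (J : finType).
Variables (cell : X -> set T) (child : X -> J -> X).
Hypothesis mcell : forall c, measurable (cell c).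
Hypothesis cellE : forall c, cell c = \bigcup_j cell (child c j).
Hypothesis cellD : forall c j k x,
  cell (child c j) x -> cell (child c k) x -> j = k.
Local Open Scope ereal_scope.
Variables (mu nu : {measure set T -> \bar R}) (g : T -> R).
Hypothesis muoo : forall c, mu (cell c) < +oo.
Hypothesis nuoo : forall c, nu (cell c) < +oo.
Hypothesis dyadic : forall (m : {measure set T -> \bar R}) c,
  m (cell c) < +oo -> measurable `<=` approximable cell child m c.
Hypothesis mg : measurable_fun setT g.
Hypothesis g0 : forall x, (0 <= g x)%R.
Hypothesis nuE : forall E, measurable E -> nu E = \int[mu]_(x in E) (g x)%:E.
Variables K b : R.
Hypothesis K1 : (1 <= K)%R.
Hypothesis muK : forall c j, mu (cell c) <= K%:E * mu (cell (child c j)).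
Hypothesis b01 : (0 < b < 1)%R.
Hypothesis nub : forall c E, measurable E -> E `<=` cell c ->
  2%:E * mu E <= mu (cell c) -> nu E <= b%:E * nu (cell c).

Local Notation stopping := (stopping cell child mu nu).

Let mstopping t c : measurable (stopping t c).
Proof. exact: measurable_stopping. Qed.

Let mgE : measurable_fun setT (EFin \o g).
Proof. exact/measurable_EFinP. Qed.

(** On this set nu is at most t mu by differentiation and at least 2 t mu by
    the size of g. *)
Let outside_small t c : (0 < t)%R ->
  mu ((cell c `\` stopping t c) `&` [set x | 2 * t <= g x]%R) = 0.
Proof.
move=> t0; set Z := _ `&` _.
have mD : measurable (cell c `\` stopping t c) by exact: measurableD.
have mZ : measurable Z.
  rewrite /Z -[X in _ `&` X]setTI; apply: measurableI => //.
  by apply: measurable_fun_ler => //; exact: measurable_cst.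
have Zc : mu Z <= mu (cell c).
  by apply: le_measure; rewrite ?inE// => x [[]].
have Zoo : mu Z \is a fin_num.
  by rewrite ge0_fin_numE//; exact: le_lt_trans (muoo c).
have nuZ : nu Z <= t%:E * mu Z.
  apply: (density_outside mcell cellE cellD muoo t0 (c := c)).
    by move=> x [].
  apply: dyadic => //; rewrite (_ : _ (cell c) = mu (cell c) + nu (cell c)).
    by apply: lte_add_pinfty.
  exact: measure_addE.
have : (2 * t)%:E * mu Z <= nu Z.
  rewrite nuE// -integral_cst//; apply: ge0_le_integral => //.
  - by move=> x _; rewrite lee_fin mulr_ge0// ltW.
  - exact: measurable_funTS.
  - by move=> x [_]; rewrite lee_fin.
have Z0 : 0 <= mu Z by [].
move=> /le_trans/(_ nuZ); move: Zoo Z0.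
case: (mu Z) => // r _; rewrite -!EFinM !lee_fin => r0 h.
apply/eqP; rewrite eqe eq_le r0 andbT.
move: h; rewrite -mulrA -subr_ge0 (_ : _ - _ = - (t * r))%R; last by ring.
by rewrite oppr_ge0 pmulr_rle0.
Qed.

(** The stopping sets for the heights t (2 K)^j carry geometrically decreasing
    nu-mass, and outside of the j-th one g is at most 2 t (2 K)^j almost
    everywhere. If e is so small that (2 K)^e b < 1, summing over j gives the
    integrability of g^(1+e). *)
Lemma reverse_hoelder : exists e C : R, [/\ (0 < e)%R, (0 < C)%R &
  forall c t, (0 < t)%R -> nu (cell c) <= t%:E * mu (cell c) ->
    \int[mu]_(x in cell c) (g x `^ (1 + e))%:E <=
    (C * t `^ (1 + e))%:E * mu (cell c)].
Proof.
have [b0 b1] := andP b01.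
have K0 : (0 < K)%R by exact: lt_le_trans K1.
pose A : R := (2 * K)%R; have A0 : (0 < A)%R by rewrite mulr_gt0.
have A2 : (2 <= A)%R by rewrite ler_peMr.
have A1 : (1 < A)%R by rewrite (lt_le_trans _ A2)// ltr1n.
(* e is chosen so that A^e b = r < 1 *)
pose r : R := ((1 + b) / 2)%R.
have r0 : (0 < r)%R by rewrite divr_gt0// addr_gt0.
have r1 : (r < 1)%R by rewrite /r; lra.
have rb : (1 < r / b)%R by rewrite ltr_pdivlMr// mul1r /r; lra.
pose e : R := (ln (r / b) / ln A)%R.
have e0 : (0 < e)%R by rewrite divr_gt0// ln_gt0.
have Ae : (A `^ e = r / b)%R.
  rewrite /powR gt_eqF// /e divfK ?gt_eqF ?ln_gt0// lnK// posrE.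
  by rewrite divr_gt0.
exists e, (2 `^ e / (b * (1 - r)))%R; split => //.
  by rewrite divr_gt0 ?powR_gt0// mulr_gt0// subr_gt0.
move=> c t0 t00 ct.
pose t j : R := (t0 * A ^+ j)%R.
have tj0 j : (0 < t j)%R by rewrite mulr_gt0// exprn_gt0.
(* a point where g is at least 2 t_j lies in Om j.+1, up to the null set Zu *)
pose Om j := if j is j'.+1 then stopping (t j') c else cell c.
have mOm j : measurable (Om j) by case: j => [|j]; [exact: mcell|exact: mstopping].
have nuOm j : nu (Om j) <= (b^-1 * b ^+ j)%:E * nu (cell c).
  case: j => [|j] /=.
    rewrite expr0 mulr1 -[leLHS]mul1e lee_wpmul2r// lee_fin.
    by rewrite invf_ge1// ltW.
  rewrite exprS mulKf ?gt_eqF//.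
  apply: (@stopping_decayX _ _ _ _ _ _ _ mcell cellE cellD _ _ K b) => //.
  exact: ltW.
pose Z j := (cell c `\` stopping (t j) c) `&` [set x | 2 * t j <= g x]%R.
have mZ j : measurable (Z j).
  rewrite /Z -[X in _ `&` X]setTI; apply: measurableI; first exact: measurableD.
  by apply: measurable_fun_ler => //; exact: measurable_cst.
pose Zu := \bigcup_j Z j.
have mZu : measurable Zu by exact: bigcupT_measurable.
have Zu0 : mu Zu = 0.
  apply/eqP; rewrite eq_le measure_ge0 andbT.
  apply: (@le_trans _ _ (\sum_(j <oo) mu (Z j))).
    by apply: measure_sigma_subadditive => //; exact: subset_refl.
  by rewrite eseries0// => j _ _; exact: outside_small.
pose f j x := ((2 * t j) `^ e)%:E * ((EFin \o g) \_ (Om j)) x.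
have f_ge0 j x : 0 <= f j x.
  apply: mule_ge0; rewrite ?lee_fin ?powR_ge0//.
  by apply: erestrict_ge0 => y _; rewrite lee_fin.
have mgOm j : measurable_fun setT ((EFin \o g) \_ (Om j)).
  by apply/(measurable_restrictT _ _).1 => //; exact: measurable_funTS.
have mf j : measurable_fun setT (f j) by exact: measurable_funeM.
have mge : measurable_fun setT (fun x => (g x `^ (1 + e))%:E).
  by apply/measurable_EFinP; apply: measurableT_comp (measurable_powR _) _.
rewrite (ge0_negligible_integral mZu _ _ _ Zu0)//; last 2 first.
- exact: measurable_funTS.
- by move=> x _; rewrite lee_fin powR_ge0.
have mcZ : measurable (cell c `\` Zu) by exact: measurableD.
apply: (@le_trans _ _ (\int[mu]_(x in cell c `\` Zu) \sum_(j <oo) f j x)).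
  apply: ge0_le_integral => //.
  - by move=> x _; rewrite lee_fin powR_ge0.
  - exact: measurable_funTS.
  - by apply: ge0_emeasurable_sum => // j x _; exact: measurable_funTS.
  move=> x [cx nZ].
  have [k gk] : exists k, (g x < 2 * t k)%R.
    exists (Num.truncn (g x / (2 * t0))).+1.
    rewrite /t mulrA mulrC -ltr_pdivrMr ?mulr_gt0//.
    apply: lt_le_trans (truncnS_gt _) _.
    apply: (@le_trans _ _ (2%:R ^+ (Num.truncn (g x / (2 * t0))).+1)%R).
      by rewrite -natrX ler_nat ltnW// ltn_expl.
    by apply: lerXn2r; rewrite ?nnegrE// ltW.
  have /ex_minnP[j gj jmin] : exists k, (g x < 2 * t k)%R by exists k.
  have Omj : Om j x.
    case: j gj jmin => // j gj jmin /=; apply: contrapT => nS.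
    have gj' : (2 * t j <= g x)%R.
      by rewrite leNgt; apply/negP => /jmin; rewrite ltnn.
    by apply: nZ; exists j.
  apply: (@le_trans _ _ (f j x)).
    rewrite /f patchE mem_set//= -EFinM lee_fin powRD; last first.
      by rewrite gt_eqF// addr_gt0.
    rewrite powRr1// mulrC ler_wpM2r// ge0_ler_powR ?nnegrE ?(ltW e0) ?(ltW gj)//.
    by rewrite mulr_ge0// ltW.
  apply: le_trans (nneseries_lim_ge j.+1 _) => [|*]; last exact: f_ge0.
  by rewrite big_nat_recr//= leeDr// sume_ge0.
rewrite integral_nneseries//; last first.
  by move=> j; exact: measurable_funTS.
have fj j : \int[mu]_(x in cell c `\` Zu) f j x <=
    (2 `^ e * t0 `^ e / b * r ^+ j)%:E * nu (cell c).
  rewrite ge0_integralZl//; last 3 first.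
  - exact: measurable_funTS.
  - by move=> x _; apply: erestrict_ge0 => y _; rewrite lee_fin.
  - by rewrite lee_fin powR_ge0.
  rewrite -integral_mkcondr -nuE; last exact: measurableI.
  apply: (@le_trans _ _ (((2 * t j) `^ e)%:E * nu (Om j))).
    apply: lee_wpmul2l; first by rewrite lee_fin powR_ge0.
    by apply: le_measure; rewrite ?inE//; exact: measurableI.
  apply: (@le_trans _ _
      (((2 * t j) `^ e)%:E * ((b^-1 * b ^+ j)%:E * nu (cell c)))).
    by apply: lee_wpmul2l; rewrite ?lee_fin ?powR_ge0.
  rewrite muleA -EFinM; apply: lee_wpmul2r => //; rewrite lee_fin.
  rewrite /t !powRM ?mulr_ge0 ?exprn_ge0 ?(ltW t00) ?(ltW A0)//.
  rewrite -(powR_mulrn _ (ltW A0)) powRAC powR_mulrn ?powR_ge0// Ae.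
  by rewrite expr_div_n le_eqVlt; apply/orP; left; apply/eqP; field;
    rewrite ?expf_neq0 gt_eqF.
set D : R := (2 `^ e * t0 `^ e / b)%R in fj.
have D0 : (0 <= D)%R by rewrite divr_ge0 ?mulr_ge0 ?powR_ge0// ltW.
apply: (@le_trans _ _ ((D / (1 - r))%:E * nu (cell c))).
  apply: lime_le.
    by apply: is_cvg_nneseries => j _ _; exact: integral_ge0.
  apply: nearW => k.
  apply: (@le_trans _ _ (\sum_(0 <= j < k) (D * r ^+ j)%:E * nu (cell c))).
    by apply: lee_sum => j _; exact: fj.
  rewrite -ge0_sume_distrl; last first.
    by move=> j _; rewrite lee_fin mulr_ge0// exprn_ge0// ltW.
  apply: lee_wpmul2r => //; rewrite sumEFin lee_fin -mulr_sumr.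
  rewrite ler_wpM2l//.
  have rn1 : (r != 1)%R by rewrite lt_eqF.
  have h := congr1 (fun u => u k) (geometric_seriesE 1%R rn1).
  rewrite (_ : (\sum_(0 <= i < k) r ^+ i)%R = ((1 * (1 - r ^+ k)) / (1 - r))%R).
    rewrite mul1r -[leRHS]mul1r ler_wpM2r ?invr_ge0 ?subr_ge0 ?(ltW r1)//.
    by rewrite lerBlDr lerDl exprn_ge0// ltW.
  by apply: etrans h; apply: eq_bigr => i _; rewrite /= mul1r.
apply: (@le_trans _ _ ((D / (1 - r))%:E * (t0%:E * mu (cell c)))).
  by apply: lee_wpmul2l => //; rewrite lee_fin divr_ge0// subr_ge0 ltW.
rewrite muleA -EFinM; apply: lee_wpmul2r => //; rewrite lee_fin.
rewrite powRD ?powRr1 ?(ltW t00)//; last by rewrite gt_eqF// addr_gt0.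
rewrite le_eqVlt; apply/orP; left; apply/eqP; rewrite /D; field.
by rewrite !lt0r_neq0// subr_gt0.
Qed.

End reverse_hoelder.
(** * Dyadic cubes of R^n *)

Section dyadic_cubes.
Context {R : realType} (n : nat).
Notation leb := (@lebesgueRn R n).
Implicit Types (c : 'rV[R]_n * {posnum R}) (e : {ffun 'I_n -> bool}).

(** Half-open cubes, given by their lower corner and their side length: unlike
    the closed cubes they are the disjoint unions of their 2^n halves. *)
Definition dcube c : set 'rV[R]_n :=
  [set x | forall i, x ord0 i \in `[c.1 ord0 i, c.1 ord0 i + c.2%:num[].

Definition dchild c e : 'rV[R]_n * {posnum R} :=
  (c.1 + \row_i (if e i then c.2%:num / 2 else 0), (c.2%:num / 2)%:pos).

Lemma measurable_rV_preimage (i : 'I_n) (A : set (measurableTypeR R)) :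
  measurable A -> measurable [set x : 'rV[R]_n | A (x ord0 i)].
Proof.
move=> mA; rewrite -[X in measurable X]setTI.
exact: (measurable_rV_coord i).
Qed.

Lemma measurable_dcube c : measurable (dcube c).
Proof.
rewrite (_ : dcube c = \bigcap_i [set x : 'rV[R]_n |
    `[c.1 ord0 i, c.1 ord0 i + c.2%:num[%classic (x ord0 i)]).
  apply: fin_bigcap_measurable => // i _.
  exact: (@measurable_rV_preimage i `[c.1 ord0 i, c.1 ord0 i + c.2%:num[).
by apply/seteqP; split=> x /= h i; [move=> _|]; exact: h.
Qed.

Lemma dchildP c e (x : 'rV[R]_n) : dcube (dchild c e) x <->
  dcube c x /\ forall i, e i = (c.1 ord0 i + c.2%:num / 2 <= x ord0 i).
Proof.
have s0 : 0 < c.2%:num by [].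
rewrite /dcube/=; set s := c.2%:num in s0 *.
split=> [h|[h he] i]; last first.
  have := h i; rewrite !in_itv/= !mxE he => /andP[? ?].
  by case: (leP (c.1 ord0 i + s / 2)) => ?; apply/andP; split; lra.
split=> i; have := h i; rewrite !in_itv/= !mxE.
  by case: (e i) => /andP[? ?]; apply/andP; split; lra.
by case: (e i) => /andP[? ?]; apply/esym;
  [apply/idP|apply/negbTE; rewrite -ltNge]; lra.
Qed.

Lemma dcubeE c : dcube c = \bigcup_e dcube (dchild c e).
Proof.
apply/seteqP; split=> [x cx|x [e _ /dchildP[]//]].
exists [ffun i => c.1 ord0 i + c.2%:num / 2 <= x ord0 i] => //.
by apply/dchildP; split=> // i; rewrite ffunE.
Qed.

Lemma dcubeD c e e' x : dcube (dchild c e) x -> dcube (dchild c e') x -> e = e'.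
Proof.
by move=> /dchildP[_ h] /dchildP[_ h']; apply/ffunP => i; rewrite h h'.
Qed.

Lemma same_dcube_dist N c x y : same_cell dcube dchild N c x y ->
  forall i, `|x ord0 i - y ord0 i| < c.2%:num / 2 ^+ N.
Proof.
elim: N c => [c [cx cy] i|N ih c [e /ih h] i].
  have := cx i; have := cy i; rewrite !in_itv/= expr0 divr1.
  move=> /andP[? ?] /andP[? ?].
  by rewrite ltr_norml; apply/andP; split; lra.
by have := h i; rewrite /= exprS invfM mulrA.
Qed.

(** The open coordinate half-spaces generate the sigma-algebra and contain
    a dyadic cube around each of their points. *)
Lemma dyadic_approximation (m : {measure set 'rV[R]_n -> \bar R}) c :
  (m (dcube c) < +oo)%E -> measurable `<=` approximable dcube dchild m c.
Proof.
move=> moo.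
have sa := sigma_algebra_approximable measurable_dcube dcubeE moo.
apply: smallest_sub; first exact: sa.
rewrite -bigcup_seq/=; apply: bigcup_sub => i _ _ [Y mY <-].
rewrite setTI; have {mY} : (@RGenOInfty.G R).-sigma.-measurable Y.
  by rewrite -RGenOInfty.measurableE.
move: Y.
apply: smallest_sub.
  have [s0 sC sU] := sa; split.
  - by rewrite /= preimage_set0.
  - by move=> A /= /sC; rewrite !setTD preimage_setC.
  - by move=> F /= /sU; rewrite preimage_bigcup.
move=> _ [r ->]; apply: (approximable_open measurable_dcube dcubeE dcubeD moo).
  exact: (@measurable_rV_preimage i `]r, +oo[).
move=> x cx /=; rewrite in_itv/= andbT => rx.
have rx0 : 0 < x ord0 i - r by rewrite subr_gt0.
exists (Num.truncn (c.2%:num / (x ord0 i - r))).+1 => y /same_dcube_dist/(_ i) xy.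
rewrite in_itv/= andbT.
suff : c.2%:num / 2 ^+ (Num.truncn (c.2%:num / (x ord0 i - r))).+1 <= x ord0 i - r.
  move=> h; have := lt_le_trans xy h; rewrite ltr_norml => /andP[_]; lra.
rewrite ler_pdivrMr ?exprn_gt0// mulrC -ler_pdivrMr//.
rewrite ltW// (lt_le_trans (truncnS_gt _))// -natrX ler_nat.
by rewrite ltnW// ltn_expl.
Qed.

End dyadic_cubes.

Lemma lebesgueRn_itv_box (R : realType) (n : nat) (a : 'I_n -> R) (s : R) : 0 < s ->
  lebesgueRn n [set x : 'rV[R]_n | forall i, x ord0 i \in `[a i, a i + s[] =
  (s ^+ n)%:E.
Proof.
move=> s0; have mbox m (b : 'I_m -> R) :
    measurable [set x : 'rV[R]_m | forall i, x ord0 i \in `[b i, b i + s[].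
  have := @measurable_dcube R m (\row_i b i, PosNum s0).
  rewrite (_ : dcube _ = [set x | forall i, x ord0 i \in `[b i, b i + s[])//.
  by apply/seteqP; split=> x /= h i; have := h i; rewrite mxE.
elim: n a => [|n IH] a.
  by rewrite /= diracE mem_set// => -[].
rewrite exprS EFinM -(IH (fun i => a (lift ord0 i))).
have := lebesgue_measure_itv `[a ord0, a ord0 + s[; rewrite /= lte_fin ltrDl s0.
rewrite -EFinD addrAC subrr add0r => <-; rewrite -lebesgueRnSE//.
congr (_ _); apply/seteqP; split=> x /= => [h|[h0 h] i].
  by split => [|i]; rewrite ?mxE; exact: h.
case: (unliftP ord0 i) => [j|] -> //.
by have := h j; rewrite mxE.
Qed.

Section cubes.
Context {R : realType} (n : nat).
Notation leb := (@lebesgueRn R n).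

Lemma lebesgueRn_dcube (c : 'rV[R]_n * {posnum R}) :
  leb (dcube c) = (c.2%:num ^+ n)%:E.
Proof. exact: lebesgueRn_itv_box. Qed.

Lemma cubeE (x : 'rV[R]_n) l : cube x l =
  [set y | forall i, y ord0 i \in `[x ord0 i - l / 2, x ord0 i + l / 2]].
Proof.
by apply/seteqP; split=> y /= h i; have := h i; rewrite in_itv/= ler_distl.
Qed.

Lemma measurable_cube (x : 'rV[R]_n) l : measurable (cube x l).
Proof. by rewrite cubeE; exact: measurable_rV_box. Qed.

Lemma lebesgueRn_cube (x : 'rV[R]_n) l : 0 < l -> leb (cube x l) = (l ^+ n)%:E.
Proof.
move=> l0; rewrite cubeE lebesgueRn_box; last by move=> i; lra.
rewrite (eq_bigr (fun=> l)); last by move=> i _; lra.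
by rewrite prodr_const card_ord.
Qed.

Lemma sub_cube (x : 'rV[R]_n) l l' : l <= l' -> cube x l `<=` cube x l'.
Proof. by move=> ll y h i; apply: le_trans (h i) _; lra. Qed.

Lemma dcube_sub_cube (c : 'rV[R]_n * {posnum R}) :
  dcube c `<=` cube (c.1 + \row__ (c.2%:num / 2)) c.2%:num.
Proof.
move=> y h i; have := h i; rewrite in_itv/= !mxE ler_distl => /andP[? ?].
by apply/andP; split; lra.
Qed.

End cubes.

(** * Muckenhoupt weights *)

Section density_measure.
Context d (T : measurableType d) (R : realType) (mu : {measure set T -> \bar R}).
Variable g : T -> R.
Local Open Scope ereal_scope.

(** The proofs are arguments so that the measure structure can be inferred from
    the term. *)
Definition density_measure of measurable_fun setT g & (forall x, (0 <= g x)%R) :=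
  fun A : set T => \int[mu]_(x in A) (g x)%:E.

Hypothesis mg : measurable_fun setT g.
Hypothesis g0 : forall x, (0 <= g x)%R.
Local Notation nu := (density_measure mg g0).

Let nu0 : nu set0 = 0. Proof. exact: integral_set0. Qed.

Let nu_ge0 A : 0 <= nu A.
Proof. by apply: integral_ge0 => x _; rewrite lee_fin. Qed.

Let nu_sigma_additive : semi_sigma_additive nu.
Proof.
apply: semi_sigma_additive_nng_induced; first exact/measurable_EFinP.
by move=> x; rewrite lee_fin.
Qed.

HB.instance Definition _ := isMeasure.Build _ _ _ nu nu0 nu_ge0 nu_sigma_additive.

End density_measure.
(** If g exceeds u^(-1/(q-1)) then g^(q-1) u exceeds 1. This crude form of
    Young's inequality replaces Hoelder's inequality below. *)
Lemma le_powRM_Dpowr (R : realType) (q g u : R) : 1 < q -> 0 <= g -> 0 < u ->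
  g <= g `^ q * u + u `^ (- (q - 1)^-1).
Proof.
move=> q1 g0 u0; set k := (q - 1)^-1.
have q10 : 0 < q - 1 by rewrite subr_gt0.
have [h|h] := leP g (u `^ (- k)).
  by rewrite (le_trans h)// lerDr mulr_ge0 ?powR_ge0 ?(ltW u0).
have gp : 0 < g by rewrite (le_lt_trans _ h)// powR_ge0.
suff gu : 1 <= g `^ (q - 1) * u.
  rewrite -[leLHS]addr0 lerD ?powR_ge0//.
  have -> : g `^ q = g * g `^ (q - 1).
    rewrite -[X in X * _]powRr1// -powRD; first by congr (_ `^ _); ring.
    by rewrite (lt0r_neq0 gp) implybT.
  by rewrite -mulrA ler_peMr.
rewrite -ler_pdivrMr// mul1r.
have -> : u^-1 = (u `^ (- k)) `^ (q - 1).
  by rewrite -powRrM mulNr mulVf ?gt_eqF// powR_inv1// ltW.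
by rewrite ge0_ler_powR ?nnegrE ?powR_ge0 ?(ltW q10) ?(ltW gp) ?(ltW h).
Qed.

Section muckenhoupt.
Context {R : realType} (n : nat) (p : R) (w : 'rV[R]_n -> R).
Notation leb := (@lebesgueRn R n).
Hypothesis p1 : 1 < p.
Hypothesis Ap : muckenhoupt p w.

Let k : R := (p - 1)^-1.
Let sigma (x : 'rV[R]_n) : R := w x `^ (- k).

Let p10 : 0 < p - 1. Proof. by rewrite subr_gt0. Qed.
Let k0 : 0 < k. Proof. by rewrite invr_gt0. Qed.
Let w0 x : 0 <= w x. Proof. by case: Ap => -[]. Qed.
Let mw : measurable_fun setT w. Proof. by case: Ap => -[]. Qed.
Let mwE : measurable_fun setT (fun x => (w x)%:E).
Proof. exact/measurable_EFinP. Qed.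
Let wae : {ae leb, forall x, 0 < w x}. Proof. by case: Ap => -[]. Qed.
Let msg : measurable_fun setT sigma.
Proof. exact: measurableT_comp (measurable_powR _) _. Qed.
Let msgE : measurable_fun setT (fun x => (sigma x)%:E).
Proof. exact/measurable_EFinP. Qed.
Let sg0 x : 0 <= sigma x. Proof. exact: powR_ge0. Qed.

Lemma weight_cube_fin x l : 0 < l ->
  exists2 a, 0 < a & wmeasure w (cube x l) = a%:E.
Proof.
move=> l0; have [[_ _ _ woo] _] := Ap.
have mQ := measurable_cube x l.
have ge0 : (0 <= wmeasure w (cube x l))%E.
  by apply: integral_ge0 => y _; rewrite lee_fin.
have fin : wmeasure w (cube x l) \is a fin_num.
  by rewrite ge0_fin_numE// woo.
exists (fine (wmeasure w (cube x l))); last by rewrite fineK.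
rewrite lt_neqAle fine_ge0// andbT eq_sym; apply/negP => /eqP f0.
have : (\int[leb]_(y in cube x l) `|(w y)%:E| = 0)%E.
  transitivity (wmeasure w (cube x l)); last by rewrite -(fineK fin) f0.
  by apply: eq_integral => y _; rewrite gee0_abs// lee_fin.
move=> /(ae_eq_integral_abs leb mQ (measurable_funTS mwE)) wQ0.
have : leb.-negligible (cube x l).
  have : \forall y \ae leb, ~ cube x l y.
    near=> y => Qy.
    have : 0 < w y by near: y.
    have : (w y)%:E = 0%E by apply: (near wQ0 y).
    by case=> ->; rewrite ltxx.
  by apply: negligibleS => y Qy /=; apply.
move=> /(negligibleP leb mQ) h.
have : (l ^+ n)%:E = 0%E :> \bar R by rewrite -(lebesgueRn_cube x l0); exact: h.
case=> /eqP.
by rewrite expf_eq0 gt_eqF// andbF.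
Unshelve. all: by end_near.
Qed.

(** The A_p condition, solved for the mass of the dual weight. *)
Lemma dual_weight_cube : exists2 C : R, 1 <= C & forall x l a, 0 < l ->
  wmeasure w (cube x l) = a%:E -> exists2 s,
    (\int[leb]_(y in cube x l) (sigma y)%:E = s%:E)%E &
    s <= l ^+ n * (C * l ^+ n / a) `^ k.
Proof.
have [_ [C0 hC]] := Ap; exists (Num.max 1 C0); first by rewrite le_max lexx.
set C := Num.max 1 C0.
have C1 : 1 <= C by rewrite le_max lexx.
move=> x l a l0 wa.
have [a' a0 wa'] := weight_cube_fin x l0.
move: wa'; rewrite wa => -[aa']; rewrite -{a'}aa' in a0.
have V0 : 0 < l ^+ n by rewrite exprn_gt0.
have VE : ((l ^+ n)%:E^-1 = (l ^+ n)^-1%:E :> \bar R)%E.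
  by rewrite inver gt_eqF.
have := hC x l l0; rewrite /average lebesgueRn_cube// VE.
rewrite -/(wmeasure w (cube x l)) wa -/k.
rewrite -/(sigma _); set I := integral _ _ _.
have I0 : (0 <= I)%E.
  by apply: integral_ge0 => y _; rewrite lee_fin powR_ge0.
have Va0 : 0 < (l ^+ n)^-1 * a by rewrite mulr_gt0// invr_gt0.
case: I I0 => [s||//]; last first.
  rewrite gt0_muley ?lte_fin ?invr_gt0// poweRyr ?gt_eqF//.
  by rewrite -EFinM gt0_muley ?lte_fin// leye_eq.
rewrite lee_fin => s0; rewrite -!EFinM lee_fin => h.
exists s => //.
have {}h : ((l ^+ n)^-1 * s) `^ (p - 1) <= C * l ^+ n / a.
  rewrite ler_pdivlMr// -ler_pdivrMr// mulrC [_ * a]mulrC mulrA.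
  by rewrite (le_trans h)// le_max lexx orbT.
rewrite mulrC -ler_pdivrMr// mulrC.
rewrite -[leLHS]powRr1 ?mulr_ge0 ?invr_ge0 ?(ltW V0)//.
rewrite -(mulfV (lt0r_neq0 p10)) powRrM -/k.
by rewrite ge0_ler_powR ?nnegrE ?powR_ge0 ?(ltW k0)// (le_trans _ h)// powR_ge0.
Qed.

(** Integrate 1 <= t w + (t w)^(-1/(p-1)) over E. *)
Lemma dual_weight_trade (t : R) E : 0 < t -> measurable E ->
  (leb E <= t%:E * wmeasure w E +
    (t `^ (- k))%:E * \int[leb]_(y in E) (sigma y)%:E)%E.
Proof.
move=> t0 mE.
rewrite -[leLHS]mul1e -(integral_cst leb mE) /wmeasure.
have wE0 y : E y -> (0 <= (w y)%:E)%E by rewrite lee_fin.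
have sE0 y : E y -> (0 <= (sigma y)%:E)%E by rewrite lee_fin.
have mwS : measurable_fun E (fun x => (w x)%:E) by exact: measurable_funTS.
have msS : measurable_fun E (fun x => (sigma x)%:E) by exact: measurable_funTS.
rewrite -(ge0_integralZl_EFin leb mE wE0 mwS (ltW t0)).
rewrite -(ge0_integralZl_EFin leb mE sE0 msS (powR_ge0 _ _)).
rewrite -ge0_integralD//; last 4 first.
- by move=> y _; rewrite -EFinM lee_fin mulr_ge0// ltW.
- exact: measurable_funeM.
- by move=> y _; rewrite -EFinM lee_fin mulr_ge0// powR_ge0.
- exact: measurable_funeM.
apply: ae_ge0_le_integral => //.
- by move=> y _; rewrite -!EFinM -EFinD lee_fin addr_ge0// mulr_ge0 ?powR_ge0// ltW.
- by apply: emeasurable_funD; exact: measurable_funeM.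
apply: filterS wae => y wy _.
rewrite -!EFinM -EFinD lee_fin /sigma -powRM ?(ltW t0)//.
have := @le_powRM_Dpowr R p 1 (t * w y) p1 ler01 (mulr_gt0 t0 wy).
by rewrite powR1 mul1r.
Qed.

(** The complement of E in the cube has at least half of its volume. Apply the
    previous inequality to it, with t such that the first term is a quarter of
    the volume: the second one is then at least another quarter, and by the A_p
    condition this is a fixed proportion of the mass of the cube. *)
Lemma dual_weight_Ainfty : exists2 b : R, 0 < b < 1 &
  forall c E, measurable E -> E `<=` dcube c ->
    (2%:E * leb E <= leb (dcube c))%E ->
    (density_measure leb msg sg0 E <=
      b%:E * density_measure leb msg sg0 (dcube c))%E.
Proof.
have [C C1 hC] := dual_weight_cube.
have C0 : 0 < C by exact: lt_le_trans C1.
pose be : R := 4^-1 * (4 * C) `^ (- k).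
have be0 : 0 < be by rewrite mulr_gt0// powR_gt0// mulr_gt0.
have be1 : be < 1.
  have : (4 * C) `^ (- k) <= 1.
    rewrite powRN invf_le1 ?powR_gt0 ?mulr_gt0//.
    rewrite -[leLHS](powRr0 (4 * C)); apply: ler_powR (ltW k0); lra.
  by rewrite /be; lra.
exists (1 - be); first by apply/andP; split; lra.
move=> c E mE Ec E2.
set l := c.2%:num; have l0 : 0 < l by rewrite /l.
set z := c.1 + \row__ (l / 2).
have cQ : dcube c `<=` cube z l by exact: dcube_sub_cube.
have mc := measurable_dcube c; have mQ := measurable_cube z l.
have [a a0 wa] := weight_cube_fin z l0.
have [s Is sle] := hC _ _ _ l0 wa.
set V := l ^+ n in sle *; have V0 : 0 < V by rewrite exprn_gt0.
have lc : leb (dcube c) = V%:E by exact: lebesgueRn_dcube.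
pose nu : {measure set 'rV[R]_n -> \bar R} := density_measure leb msg sg0.
change (nu E <= (1 - be)%:E * nu (dcube c))%E.
have nuc : (nu (dcube c) <= s%:E)%E.
  rewrite -Is; apply: ge0_subset_integral => //; first exact: measurable_funTS.
  by move=> y _; rewrite lee_fin.
have nucfin : nu (dcube c) \is a fin_num.
  by rewrite ge0_fin_numE ?measure_ge0// (le_lt_trans nuc)// ltry.
have mF : measurable (dcube c `\` E) by exact: measurableD.
set F := dcube c `\` E in mF.
have cEF : dcube c = E `|` F by rewrite setDUK.
have EF0 : E `&` F = set0 by apply/seteqP; split=> // y [Ey [_]].
have nuEF : (nu (dcube c) = nu E + nu F)%E.
  by rewrite [in LHS]cEF measureU.
have leEF : (leb (dcube c) = leb E + leb F)%E.
  by rewrite [in LHS]cEF measureU.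
have wF : (wmeasure w F <= a%:E)%E.
  rewrite -wa; apply: ge0_subset_integral => //; first exact: measurable_funTS.
  - by move=> y _; rewrite lee_fin.
  - by move=> y [/cQ].
pose t := V / (4 * a); have t0 : 0 < t by rewrite divr_gt0// mulr_gt0.
have trade : (leb F <= t%:E * wmeasure w F + (t `^ (- k))%:E * nu F)%E.
  exact: dual_weight_trade.
have nuEfin : nu E \is a fin_num.
  rewrite ge0_fin_numE ?measure_ge0//.
  apply: le_lt_trans (_ : nu (dcube c) < +oo)%E.
    by apply: le_measure; rewrite ?inE.
  by rewrite -ge0_fin_numE ?measure_ge0.
have nuFfin : nu F \is a fin_num.
  rewrite ge0_fin_numE ?measure_ge0//.
  apply: le_lt_trans (_ : nu (dcube c) < +oo)%E.
    by apply: le_measure; rewrite ?inE// => y [].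
  by rewrite -ge0_fin_numE ?measure_ge0.
have lEfin : leb E \is a fin_num.
  rewrite ge0_fin_numE ?measure_ge0//.
  apply: le_lt_trans (_ : leb (dcube c) < +oo)%E.
    by apply: le_measure; rewrite ?inE.
  by rewrite lc ltry.
have lFfin : leb F \is a fin_num.
  rewrite ge0_fin_numE ?measure_ge0//.
  apply: le_lt_trans (_ : leb (dcube c) < +oo)%E.
    by apply: le_measure; rewrite ?inE// => y [].
  by rewrite lc ltry.
have wFfin : wmeasure w F \is a fin_num.
  rewrite ge0_fin_numE ?(le_lt_trans wF) ?ltry//.
  by apply: integral_ge0 => y _; rewrite lee_fin.
move: nuEF leEF wF E2 nuc trade; rewrite lc.
rewrite -(fineK nuEfin) -(fineK nuFfin) -(fineK lEfin) -(fineK lFfin).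
rewrite -(fineK wFfin).
move=> ->; rewrite -!EFinM -!EFinD !lee_fin => -[].
move: (fine (nu E)) (fine (nu F)) (fine (leb E)) (fine (leb F))
  (fine (wmeasure w F)).
move=> nE nF lE lF wf VEF wfa E2 nEFs lFle.
have {}wfa : t * wf <= V / 4.
  apply: (@le_trans _ _ (t * a)); first by rewrite ler_pM2l.
  by rewrite /t le_eqVlt; apply/orP; left; apply/eqP; field; rewrite gt_eqF.
have h1 : V / 4 <= t `^ (- k) * nF by lra.
suff : be * (nE + nF) <= nF by lra.
have h2 : be * (nE + nF) <= be * (V * (C * V / a) `^ k).
  by rewrite ler_pM2l// (le_trans nEFs).
apply: (le_trans h2).
have -> : C * V / a = 4 * C * t by rewrite /t; field; rewrite gt_eqF.
have -> : (4 * C * t) `^ k = (4 * C) `^ k * t `^ k.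
  by rewrite powRM ?(ltW t0)// mulr_ge0// ltW.
rewrite /be (_ : (4 * C) `^ (- k) = ((4 * C) `^ k)^-1); last by rewrite powRN.
have X0 : 0 < (4 * C) `^ k by rewrite powR_gt0// mulr_gt0.
have -> : 4^-1 / (4 * C) `^ k * (V * ((4 * C) `^ k * t `^ k)) = V / 4 * t `^ k.
  by field; rewrite gt_eqF.
by rewrite -ler_pdivlMr ?powR_gt0// (le_trans h1)// powRN mulrC.
Qed.


(** The same inequality for the smaller cube, with t such that the first term is
    half of its volume; the second one is estimated by the A_p condition on the
    larger cube. *)
Lemma weight_doubling : exists2 M : R, 0 < M & forall z l a a', 0 < l ->
  wmeasure w (cube z l) = a%:E -> wmeasure w (cube z (4 * l)) = a'%:E ->
  a' <= M * a.
Proof.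
have [C C1 hC] := dual_weight_cube.
have C0 : 0 < C by exact: lt_le_trans C1.
pose y : R := 2 * 4 ^+ n; have y0 : 0 < y by rewrite mulr_gt0// exprn_gt0.
exists (y * C * y `^ (p - 1)); first by rewrite !mulr_gt0// powR_gt0.
move=> z l a a' l0 wa wa'.
have l40 : 0 < 4 * l by rewrite mulr_gt0.
have a0 : 0 < a by have [b b0] := weight_cube_fin z l0; rewrite wa => -[->].
have a'0 : 0 < a' by have [b b0] := weight_cube_fin z l40; rewrite wa' => -[->].
have mQ := measurable_cube z l; have mQ' := measurable_cube z (4 * l).
have [s Is sle] := hC _ _ _ l40 wa'.
set V := l ^+ n; have V0 : 0 < V by rewrite exprn_gt0.
have V4 : (4 * l) ^+ n = 4 ^+ n * V by rewrite exprMn.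
pose t := V / (2 * a); have t0 : 0 < t by rewrite divr_gt0// mulr_gt0.
have := dual_weight_trade t0 mQ; rewrite lebesgueRn_cube// wa.
have Is' : (\int[leb]_(y in cube z l) (sigma y)%:E <= s%:E)%E.
  rewrite -Is; apply: ge0_subset_integral => //; first exact: measurable_funTS.
  - by move=> u _; rewrite lee_fin.
  - by apply: sub_cube; lra.
move=> h; have {h} : (V%:E <= t%:E * a%:E + (t `^ (- k))%:E * s%:E)%E.
  apply: (le_trans h); apply: leeD => //.
  by apply: lee_wpmul2l => //; rewrite lee_fin powR_ge0.
rewrite -!EFinM -EFinD lee_fin (_ : t * a = V / 2); last first.
  by rewrite /t; field; rewrite gt_eqF.
move=> h; have {}h : V / 2 <= t `^ (- k) * s by lra.
have {}h : V / 2 <= t `^ (- k) * ((4 * l) ^+ n * (C * (4 * l) ^+ n / a') `^ k).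
  by apply: (le_trans h); rewrite ler_pM2l// powR_gt0.
have {}h : 1 <= y * (y * C * (a / a')) `^ k.
  move: h; rewrite V4 -(@ler_pM2l _ (2 / V)) ?divr_gt0//.
  rewrite (_ : 2 / V * (V / 2) = 1); last by field; rewrite gt_eqF.
  move=> h; apply: (le_trans h); rewrite le_eqVlt; apply/orP; left; apply/eqP.
  have -> : y * C * (a / a') = (C * (4 ^+ n * V) / a') / t.
    by rewrite /t /y; field; rewrite !gt_eqF.
  rewrite [in RHS]powRM ?invr_ge0 ?(ltW t0) ?divr_ge0 ?mulr_ge0 ?exprn_ge0
    ?(ltW l0) ?(ltW C0) ?(ltW V0) ?(ltW a'0)//.
  have -> : t^-1 `^ k = t `^ (- k).
    by rewrite -powR_inv1 ?(ltW t0)// -powRrM mulN1r.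
  by rewrite /y; field; rewrite gt_eqF.
rewrite leNgt; apply/negP => aa'.
have ay : y * C * (a / a') < y `^ (- (p - 1)).
  rewrite mulrA ltr_pdivrMr// powRN -ltr_pdivrMl ?invr_gt0 ?powR_gt0//.
  by rewrite invrK mulrC mulrAC.
have : y * (y * C * (a / a')) `^ k < y * (y `^ (- (p - 1))) `^ k.
  rewrite ltr_pM2l// gt0_ltr_powR ?nnegrE ?powR_ge0//.
  by rewrite !mulr_ge0 ?invr_ge0// ltW.
rewrite -powRrM mulNr mulfV ?lt0r_neq0// powR_inv1 ?(ltW y0)//.
by rewrite mulfV ?lt0r_neq0// ltNge h.
Qed.

Lemma dual_weight_reverse_hoelder : exists e C : R, [/\ 0 < e, 0 < C &
  forall c t, 0 < t ->
    (density_measure leb msg sg0 (dcube c) <= t%:E * leb (dcube c))%E ->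
    (\int[leb]_(x in dcube c) (sigma x `^ (1 + e))%:E <=
     (C * t `^ (1 + e))%:E * leb (dcube c))%E].
Proof.
have [b b01 nub] := dual_weight_Ainfty.
have [C C1 hC] := dual_weight_cube.
apply: (@reverse_hoelder _ _ _ _ _ (@dcube R n) (@dchild R n) _ _ _
  leb (density_measure leb msg sg0) sigma _ _ _ _ _ _ (2 ^+ n) b) => //.
- exact: measurable_dcube.
- exact: dcubeE.
- exact: dcubeD.
- move=> c; change (leb (dcube c) < +oo)%E.
  by rewrite lebesgueRn_dcube ltry.
- move=> c; set z := c.1 + \row__ (c.2%:num / 2).
  have [a a0 wa] := weight_cube_fin z (gt0 c.2).
  have [s Is _] := hC _ _ _ (gt0 c.2) wa.
  apply: (@le_lt_trans _ _ s%:E); last exact: ltry.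
  rewrite -Is; apply: ge0_subset_integral => //.
  + exact: measurable_dcube.
  + exact: measurable_cube.
  + exact: measurable_funTS.
  + by move=> y _; rewrite lee_fin.
  + exact: dcube_sub_cube.
- exact: dyadic_approximation.
- by rewrite exprn_ege1// ler1n.
- move=> c j; change (leb (dcube c) <= (2 ^+ n)%:E * leb (dcube (dchild c j)))%E.
  rewrite !lebesgueRn_dcube -EFinM lee_fin /= -exprMn.
  by rewrite mulrC divfK.
Qed.

(** Since w^(-1/(p-1)) is integrable to a power larger than one, w belongs to
    A_q for some q < p, and by the definition of the index the function Phi
    dominates the power q. *)
Lemma average_le_orlicz (Phi : R -> R) : young_function Phi ->
  0 < upper_index Phi -> upper_index Phi = p^-1 ->
  exists2 C : R, 0 < C & forall z l lam (f : 'rV[R]_n -> R),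
    0 < l -> 0 < lam -> measurable_fun setT f ->
    ((wmeasure w (cube z (2 * l)))^-1 *
      \int[leb]_(y in cube z (2 * l)) (Phi (`|f y| / lam) * w y)%:E <= 1)%E ->
    (\int[leb]_(y in cube z l) `|f y|%:E <= (C * lam * l ^+ n)%:E)%E.
Proof.
move=> yPhi u0 up.
have [e [C1 [e0 C10 rh]]] := dual_weight_reverse_hoelder.
have [C Cge1 hC] := dual_weight_cube.
have C0 : 0 < C by exact: lt_le_trans Cge1.
have e10 : 0 < 1 + e by rewrite addr_gt0.
(* the exponent q with 1/(q-1) = m makes w^(-1/(q-1)) equal to sigma^(1+e) *)
pose m := k * (1 + e); have m0 : 0 < m by rewrite mulr_gt0.
pose q := 1 + m^-1.
have q1 : 1 < q by rewrite ltrDl invr_gt0.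
have qm : (q - 1)^-1 = m by rewrite /q addrAC subrr add0r invrK.
have qp : 0 < q < p.
  rewrite (lt_trans ltr01 q1)/= /q -ltrBrDl /m invfM /k invrK.
  by rewrite ltr_pdivrMr// ltr_pMr// ltrDl.
have [K K0 hK] := young_growth yPhi u0 up qp.
pose B := 2 * K + C1 * C `^ m.
have B0 : 0 < B by rewrite addr_gt0// mulr_gt0// powR_gt0.
exists (2 ^+ n * B); first by rewrite mulr_gt0// exprn_gt0.
move=> z l lam f l0 lam0 mf.
have l20 : 0 < 2 * l by rewrite mulr_gt0.
(* a half-open cube between the closed cubes of sides l and 2 l *)
pose c : 'rV[R]_n * {posnum R} := (z - \row__ l, PosNum l20).
set Q := cube z (2 * l).
have mQ : measurable Q by exact: measurable_cube.
have mc := measurable_dcube c.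
have cQ : dcube c `<=` Q.
  move=> y h i; have := h i; rewrite in_itv/= !mxE ler_distl => /andP[? ?].
  by apply/andP; split; lra.
have lc : cube z l `<=` dcube c.
  move=> y h i; have := h i; rewrite in_itv/= !mxE ler_distl => /andP[? ?].
  by apply/andP; split; lra.
have [a a0 wa] := weight_cube_fin z l20.
have [s Is sle] := hC _ _ _ l20 wa.
rewrite -/Q in wa Is; rewrite wa inver gt_eqF// lee_pdivrMl// mule1 => fQ.
set V := (2 * l) ^+ n in sle; have V0 : 0 < V by rewrite exprn_gt0.
have lebc : leb (dcube c) = V%:E by exact: lebesgueRn_dcube.
pose t := (C * V / a) `^ k; have t0 : 0 < t.
  by rewrite powR_gt0// divr_gt0// mulr_gt0.
have msgc : measurable_fun (dcube c) (fun x => (sigma x `^ (1 + e))%:E).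
  by apply: measurable_funTS; apply/measurable_EFinP;
    apply: measurableT_comp (measurable_powR _) _.
have {}rh : (\int[leb]_(x in dcube c) (sigma x `^ (1 + e))%:E <=
    (C1 * t `^ (1 + e) * V)%:E)%E.
  rewrite EFinM -lebc; apply: rh => //.
  apply: (@le_trans _ _ s%:E).
    rewrite -Is; apply: ge0_subset_integral => //; first exact: measurable_funTS.
    by move=> y _; rewrite lee_fin.
  by rewrite lebc -EFinM lee_fin mulrC.
have mfl : measurable_fun setT (fun y => `|f y| / lam).
  by apply: measurable_funM => //; exact: measurableT_comp mf.
have fl0 y : 0 <= `|f y| / lam by rewrite divr_ge0// ltW.
have mPhi : measurable_fun setT (fun y => (Phi (`|f y| / lam) * w y)%:E).
  apply/measurable_EFinP; apply: measurable_funM => //.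
  exact: measurable_young.
have Phi0 y : 0 <= Phi (`|f y| / lam) * w y by rewrite mulr_ge0// young_ge0.
have KV0 : 0 <= K * V / a by rewrite divr_ge0 ?mulr_ge0// ltW.
have step : (\int[leb]_(y in dcube c) (`|f y| / lam)%:E <= (B * V)%:E)%E.
  apply: (@le_trans _ _ (\int[leb]_(y in dcube c)
      ((K * V / a)%:E * (w y)%:E + (K * V / a)%:E * (Phi (`|f y| / lam) * w y)%:E
       + ((a / V) `^ m)%:E * (sigma y `^ (1 + e))%:E))%E).
    apply: ae_ge0_le_integral => //.
    - by move=> y _; rewrite lee_fin.
    - by apply: measurable_funTS; exact/measurable_EFinP.
    - move=> y _; rewrite -!EFinM -!EFinD lee_fin !addr_ge0// mulr_ge0//;
        exact: powR_ge0.
    - by apply: emeasurable_funD; [apply: emeasurable_funD|];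
        apply: measurable_funeM => //; exact: measurable_funTS.
    apply: filterS wae => y wy _; rewrite -!EFinM -!EFinD lee_fin.
    have u0' : 0 < w y * (V / a) by rewrite mulr_gt0// divr_gt0.
    apply: (le_trans (le_powRM_Dpowr q1 (fl0 y) u0')); rewrite qm; apply: lerD.
      apply: (@le_trans _ _ (K * (1 + Phi (`|f y| / lam)) * (w y * (V / a)))).
        by rewrite ler_pM2r// hK.
      by rewrite le_eqVlt; apply/orP; left; apply/eqP; ring.
    rewrite powRM ?divr_ge0 ?(ltW wy) ?(ltW V0) ?(ltW a0)// mulrC.
    rewrite /sigma -[in leRHS]powRrM mulNr -/m ler_wpM2r ?powR_ge0//.
    by rewrite -(invf_div a V) -powR_inv1 ?divr_ge0 ?(ltW a0) ?(ltW V0)//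
      -powRrM mulN1r opprK.
  have wc0 y : dcube c y -> (0 <= (w y)%:E)%E by rewrite lee_fin.
  have pc0 y : dcube c y -> (0 <= (Phi (`|f y| / lam) * w y)%:E)%E.
    by rewrite lee_fin.
  have sc0 y : dcube c y -> (0 <= (sigma y `^ (1 + e))%:E)%E.
    by rewrite lee_fin powR_ge0.
  have mwc : measurable_fun (dcube c) (fun y => (w y)%:E).
    exact: measurable_funTS.
  have mPc := measurable_funTS mPhi : measurable_fun (dcube c) _.
  rewrite ge0_integralD//; last 4 first.
  - by move=> y _; rewrite -!EFinM -EFinD lee_fin addr_ge0// mulr_ge0.
  - by apply: emeasurable_funD; exact: measurable_funeM.
  - by move=> y _; rewrite -EFinM lee_fin mulr_ge0// powR_ge0.
  - exact: measurable_funeM.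
  rewrite ge0_integralD//; last 4 first.
  - by move=> y _; rewrite -!EFinM lee_fin mulr_ge0.
  - exact: measurable_funeM.
  - by move=> y _; rewrite -EFinM lee_fin mulr_ge0.
  - exact: measurable_funeM.
  rewrite (ge0_integralZl_EFin leb mc wc0 mwc KV0).
  rewrite (ge0_integralZl_EFin leb mc pc0 mPc KV0).
  rewrite (ge0_integralZl_EFin leb mc sc0 msgc (powR_ge0 _ _)).
  apply: (@le_trans _ _ ((K * V / a)%:E * a%:E + (K * V / a)%:E * a%:E +
      ((a / V) `^ m)%:E * (C1 * t `^ (1 + e) * V)%:E)%E).
    apply: leeD; [apply: leeD|]; apply: lee_wpmul2l; rewrite ?lee_fin ?powR_ge0//.
      rewrite -wa; apply: ge0_subset_integral => //; first exact: measurable_funTS.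
      by move=> y _; rewrite lee_fin.
    apply: le_trans fQ; apply: ge0_subset_integral => //.
      exact: measurable_funTS.
    by move=> y _; rewrite lee_fin.
  rewrite -!EFinM -!EFinD lee_fin.
  have -> : t `^ (1 + e) = C `^ m / (a / V) `^ m.
    rewrite /t -powRrM -/m -mulrA powRM ?divr_ge0 ?(ltW C0) ?(ltW V0) ?(ltW a0)//.
    have -> : V / a = (a / V) `^ (- 1).
      by rewrite powR_inv1 ?invf_div// divr_ge0 ?(ltW a0) ?(ltW V0).
    by rewrite -powRrM mulN1r powRN.
  have X0 : 0 < (a / V) `^ m by rewrite powR_gt0// divr_gt0.
  rewrite le_eqVlt; apply/orP; left; apply/eqP; rewrite /B; field.
  by rewrite !gt_eqF.
have fc0 y : dcube c y -> (0 <= (`|f y| / lam)%:E)%E by rewrite lee_fin.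
have mfc : measurable_fun (dcube c) (fun y => (`|f y| / lam)%:E).
  by apply: measurable_funTS; exact/measurable_EFinP.
apply: (@le_trans _ _ (\int[leb]_(y in dcube c) `|f y|%:E)%E).
  apply: ge0_subset_integral => //; first exact: measurable_cube.
  by apply: measurable_funTS; apply/measurable_EFinP; exact: measurableT_comp mf.
rewrite (eq_integral (fun y => lam%:E * (`|f y| / lam)%:E)%E); last first.
  by move=> y _; rewrite -EFinM mulrC divfK ?gt_eqF.
rewrite (ge0_integralZl_EFin leb mc fc0 mfc (ltW lam0)).
apply: (@le_trans _ _ (lam%:E * (B * V)%:E)%E).
  by apply: lee_wpmul2l => //; rewrite lee_fin ltW.
rewrite -EFinM lee_fin /V exprMn le_eqVlt; apply/orP; left; apply/eqP; ring.
Qed.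

End muckenhoupt.
(** * Dyadic sums and the kernel *)

(** The integral of a nonnegative function is the supremum of the integrals of
    the simple functions below it, hence is monotone on arbitrary functions. *)
Lemma ge0_le_integralT d (T : measurableType d) (R : realType)
    (mu : {measure set T -> \bar R}) (f1 f2 : T -> \bar R) :
  (forall x, (0 <= f1 x)%E) -> (forall x, (f1 x <= f2 x)%E) ->
  (\int[mu]_x f1 x <= \int[mu]_x f2 x)%E.
Proof.
move=> f10 f12; rewrite !ge0_integralTE//; last first.
  by move=> x; exact: le_trans (f10 x) (f12 x).
apply: ereal_sup_le => _ [h hf <-]; exists h => // x.
exact: le_trans (hf x) (f12 x).
Qed.

(** The step function equal to b_j / (2^(j+1) l) on [2^j l, 2^(j+1) l[ is below
    the integrand, and each of its steps has integral b_j / 2. *)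
Lemma dyadic_sum_le_integral (R : realType) (F : R -> \bar R) (l : R)
    (b : nat -> R) (N : nat) : 0 < l ->
  (forall t, l <= t -> (0 <= F t)%E) -> (forall j, 0 <= b j) ->
  (forall j t, 2 ^+ j * l <= t < 2 ^+ j.+1 * l -> ((b j)%:E <= F t)%E) ->
  ((\sum_(j < N) b j)%:E <=
    2%:E * \int[@lebesgue_measure R]_(t in `[l, +oo[) (F t * (t^-1)%:E))%E.
Proof.
move=> l0 F0 b0 bF.
pose J j : set R := `[2 ^+ j * l, 2 ^+ j.+1 * l[%classic.
have mJ j : measurable (J j) by exact: measurable_itv.
have tj0 j : 0 < 2 ^+ j * l by rewrite mulr_gt0// exprn_gt0.
have tj j : 2 ^+ j.+1 * l = 2 * (2 ^+ j * l) by rewrite exprS mulrA.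
have ltj j : l <= 2 ^+ j * l by rewrite ler_peMl ?(ltW l0)// exprn_ege1// ler1n.
pose g (j : nat) (t : R) : \bar R :=
  ((b j / (2 ^+ j.+1 * l))%:E * (\1_(J j) t)%:E)%E.
have g0 j t : (0 <= g j t)%E.
  by rewrite mule_ge0 ?lee_fin// divr_ge0// ltW.
have mg j : measurable_fun setT (g j).
  by apply: measurable_funeM; apply/measurable_EFinP; exact: measurable_indic.
have gJ j : (\int[lebesgue_measure]_t g j t = (b j / 2)%:E)%E.
  rewrite ge0_integralZl_EFin//; last 2 first.
  - by apply/measurable_EFinP; apply: measurable_indic; exact: mJ.
  - by rewrite divr_ge0// ltW.
  rewrite integral_indic//; last exact: mJ.
  have lJ : (lebesgue_measure (J j `&` [set: R]) = (2 ^+ j * l)%:E)%E.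
    rewrite setIT /J lebesgue_measure_itv/= lte_fin.
    rewrite ltr_pM2r// exprS ltr_pMl ?exprn_gt0// ltr1n.
    by rewrite -EFinD; congr EFin; ring.
  transitivity ((b j / (2 ^+ j.+1 * l))%:E * (2 ^+ j * l)%:E)%E.
    by congr (_ * _)%E; exact: lJ.
  rewrite -EFinM exprS; congr EFin; field.
  by rewrite !gt_eqF// exprn_gt0.
set f := (X in (2%:E * integral _ _ X)%E).
have sumg (t : R) : (\sum_(j < N) g j t <= (f \_ `[l, +oo[%classic) t)%E /\
    (2 ^+ N * l <= t -> (\sum_(j < N) g j t = 0)%E).
  elim: N => [|M [ih1 ih2]].
    split; rewrite big_ord0//; apply: erestrict_ge0 => u /=.
    rewrite in_itv/= andbT => lu; apply: mule_ge0; first exact: F0.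
    by rewrite lee_fin invr_ge0 (le_trans (ltW l0)).
  rewrite big_ord_recr/=; have [tM|Mt] := ltP t (2 ^+ M * l).
    have -> : g M t = 0%E.
      rewrite /g indicE memNset ?mule0// /J/= in_itv/= => /andP[].
      by rewrite leNgt tM.
    rewrite adde0; split=> // h.
    by apply: ih2; apply: le_trans h; rewrite tj; have := tj0 M; lra.
  rewrite ih2// add0e; split; last first.
    move=> h; rewrite /g indicE memNset ?mule0// /J/= in_itv/= => /andP[_].
    by rewrite ltNge h.
  have lt : l <= t by exact: le_trans Mt.
  have t0 : 0 < t by exact: lt_le_trans lt.
  rewrite patchE mem_set/=; last by rewrite in_itv/= lt.
  have [tM|] := ltP t (2 ^+ M.+1 * l); last first.
    move=> h; rewrite /g indicE memNset ?mule0.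
      by apply: mule_ge0; rewrite ?F0// lee_fin invr_ge0 ltW.
    by rewrite /J/= in_itv/= => /andP[_]; rewrite ltNge h.
  rewrite /g indicE mem_set; last by rewrite /J/= in_itv/= Mt.
  rewrite mule1 EFinM; apply: lee_pmul; rewrite ?lee_fin ?invr_ge0//.
  - exact: ltW.
  - by apply: bF; rewrite Mt.
  - by rewrite lef_pV2 ?posrE// ltW.
rewrite -lee_pdivrMl// integral_mkcond.
apply: (@le_trans _ _ (\int[lebesgue_measure]_t \sum_(j < N) g j t)%E); last first.
  apply: ge0_le_integralT => t; first by apply: sume_ge0.
  by have [] := sumg t.
rewrite ge0_integral_sum//; last by move=> j; exact: mg.
rewrite (eq_bigr (fun j : 'I_N => (b j / 2)%:E)); last first.
  by move=> j _; exact: gJ.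
by rewrite sumEFin -EFinM lee_fin -mulr_suml mulrC.
Qed.

Section kernel.
Context {R : realType} (n : nat).
Notation leb := (@lebesgueRn R n).

Lemma coord_le_enorm (x : 'rV[R]_n) i : `|x ord0 i| <= enorm x.
Proof.
rewrite -sqrtr_sqr /enorm ler_wsqrtr// (bigD1 i)//= lerDl.
by apply: sumr_ge0 => j _; exact: sqr_ge0.
Qed.

Lemma cube_exhaust (z y : 'rV[R]_n) l : 0 < l ->
  exists N, cube z (2 ^+ N * l) y.
Proof.
move=> l0; set s := \sum_i `|y ord0 i - z ord0 i|.
exists (Num.truncn (2 * s / l)).+1 => i.
apply: (@le_trans _ _ s).
  by rewrite /s (bigD1 i)//= lerDl sumr_ge0.
rewrite ler_pdivlMr// mulrC -ler_pdivrMr// ltW// (lt_le_trans (truncnS_gt _))//.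
by rewrite -natrX ler_nat ltnW// ltn_expl.
Qed.

(** Decompose the complement of the cube of side 4 l into dyadic annuli and
    compare the kernel with its value on each of them. *)
Lemma kernel_integral_le (z x : 'rV[R]_n) l (f : 'rV[R]_n -> R) : 0 < l ->
  measurable_fun setT f -> (forall y, cube z (4 * l) y -> f y = 0) ->
  cube z l x ->
  (\int[leb]_y (`|f y| / enorm (x - y) ^+ n)%:E <=
   \sum_(j <oo) (((2 ^+ j * l) ^+ n)^-1)%:E *
      \int[leb]_(y in cube z (2 ^+ j.+3 * l)) `|f y|%:E)%E.
Proof.
move=> l0 mf f0 zx.
have mfE : measurable_fun setT (fun y => `|f y|%:E).
  by apply/measurable_EFinP; exact: measurableT_comp mf.
have V0 j : 0 <= ((2 ^+ j * l) ^+ n)^-1.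
  by rewrite invr_ge0 exprn_ge0// mulr_ge0 ?exprn_ge0// ltW.
pose g j y : \bar R := (((2 ^+ j * l) ^+ n)^-1%:E *
  ((fun y => `|f y|%:E) \_ (cube z (2 ^+ j.+3 * l))) y)%E.
have r0 j y : (0 <= ((fun y => `|f y|%:E) \_ (cube z (2 ^+ j.+3 * l))) y)%E.
  by apply: erestrict_ge0 => u _; rewrite lee_fin.
have mr j : measurable_fun setT
    ((fun y => `|f y|%:E) \_ (cube z (2 ^+ j.+3 * l))).
  apply/(measurable_restrictT _ _).1; first exact: measurable_cube.
  exact: measurable_funTS.
have g0 j y : (0 <= g j y)%E.
  by apply: mule_ge0; [rewrite lee_fin; exact: V0|exact: r0].
have mg j : measurable_fun setT (g j) by exact: measurable_funeM.
have -> : (\sum_(j <oo) (((2 ^+ j * l) ^+ n)^-1)%:E *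
      \int[leb]_(y in cube z (2 ^+ j.+3 * l)) `|f y|%:E =
    \int[leb]_y \sum_(j <oo) g j y)%E.
  rewrite integral_nneseries//; apply: eq_eseriesr => j _.
  rewrite [in LHS]integral_mkcond; apply/esym.
  exact: ge0_integralZl_EFin.
apply: ge0_le_integralT => y.
  by rewrite lee_fin divr_ge0// exprn_ge0// sqrtr_ge0.
have [zy|nzy] := pselect (cube z (4 * l) y).
  by rewrite f0// normr0 mul0r; apply: nneseries_ge0.
have /ex_minnP[k /asboolP ky kmin] : exists k, `[< cube z (2 ^+ k * l) y >].
  by have [k ky] := cube_exhaust z y l0; exists k; apply/asboolP.
have k3 : (2 < k)%N.
  rewrite ltnNge; apply/negP => k2; apply: nzy; apply: sub_cube ky.
  rewrite ler_pM2r// (_ : 4 = 2 ^+ 2); last by ring.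
  by rewrite ler_weXn2l// ler1n.
pose j := (k - 3)%N; have kj : k = j.+3 by rewrite -addn3 subnK.
have nj : ~ cube z (2 ^+ j.+2 * l) y.
  by move=> /asboolP/kmin; rewrite kj ltnn.
apply: (@le_trans _ _ (g j y)); last first.
  apply: le_trans (nneseries_lim_ge j.+1 _) => [|*]; last exact: g0.
  by rewrite big_nat_recr//= leeDr// sume_ge0.
rewrite /g patchE mem_set; last by rewrite -kj.
rewrite -EFinM lee_fin mulrC ler_wpM2r//.
have [i iy] : exists i, 2 ^+ j.+1 * l < `|y ord0 i - z ord0 i|.
  apply: contrapT => h; apply: nj => i; rewrite leNgt; apply/negP => hi.
  apply: h; exists i; apply: le_lt_trans hi.
  by rewrite [2 ^+ j.+2]exprS le_eqVlt; apply/orP; left; apply/eqP; field.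
have le1 : 1 <= 2 ^+ j :> R by rewrite exprn_ege1// ler1n.
have far : 2 ^+ j * l <= enorm (x - y).
  apply: le_trans (coord_le_enorm _ i); rewrite !mxE.
  have xi := zx i.
  have : `|y ord0 i - z ord0 i| <= `|x ord0 i - y ord0 i| + `|x ord0 i - z ord0 i|.
    by rewrite [X in _ <= X + _]distrC; exact: ler_distD.
  have : 1 * l <= 2 ^+ j * l by rewrite ler_pM2r.
  move: iy xi; rewrite exprS -mulrA mul1r.
  move: (2 ^+ j * l) `|y ord0 i - _| `|x ord0 i - y ord0 i| `|x ord0 i - z _ i|.
  by move=> u v a b; lra.
have u0 : 0 < 2 ^+ j * l by rewrite mulr_gt0// exprn_gt0.
rewrite lef_pV2 ?posrE ?exprn_gt0 ?(lt_le_trans u0)//.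
by rewrite lerXn2r ?nnegrE ?(ltW u0)// (le_trans (ltW u0)).
Qed.

(** The ball of radius l / 2 around a point of the cube of side 2 l, for the
    maximum norm, lies in the cube of side 4 l. *)
Lemma supp_sub_cube (z : 'rV[R]_n) l (f : 'rV[R]_n -> R) : 0 < l ->
  (forall y, cube z (4 * l) y -> f y = 0) -> supp f `<=` ~` cube z (2 * l).
Proof.
move=> l0 f0 x xf zx.
have l20 : 0 < l / 2 by rewrite divr_gt0.
have [y [/= /eqP fy [_ xy]]] := xf _ (nbhsx_ballx x _ l20).
apply: fy; apply: f0 => i; have := zx i; have := xy ord0 i.
rewrite /ball/= => h1 h2.
have : `|y ord0 i - z ord0 i| <= `|x ord0 i - y ord0 i| + `|x ord0 i - z ord0 i|.
  by rewrite [X in _ <= X + _]distrC; exact: ler_distD.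
lra.
Qed.

End kernel.
(** * Local Orlicz norms *)

Section orlicz_norm_theory.
Context {R : realType} (n : nat) (Phi : R -> R) (w : 'rV[R]_n -> R).
Notation leb := (@lebesgueRn R n).
Hypothesis yPhi : young_function Phi.
Hypothesis w0 : forall x, 0 <= w x.
Hypothesis mw : measurable_fun setT w.
Implicit Types (A : set 'rV[R]_n) (f : 'rV[R]_n -> R) (lam : R).

Lemma orlicz_norm_ge0 A f : (0 <= orlicz_norm Phi w A f)%E.
Proof.
by apply: le_ereal_inf_tmp => _ [lam [lam0 _] <-]; rewrite lee_fin ltW.
Qed.

Lemma orlicz_norm_le A f lam : 0 < lam ->
  ((wmeasure w A)^-1 * \int[leb]_(y in A) (Phi (`|f y| / lam) * w y)%:E <= 1)%E ->
  (orlicz_norm Phi w A f <= lam%:E)%E.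
Proof. by move=> lam0 h; apply: ereal_inf_lbound; exists lam. Qed.

Lemma measurable_modular f lam : measurable_fun setT f -> 0 < lam ->
  measurable_fun setT (fun y => (Phi (`|f y| / lam) * w y)%:E).
Proof.
move=> mf lam0; apply/measurable_EFinP; apply: measurable_funM => //.
apply: measurable_young => // [|y]; last by rewrite divr_ge0// ltW.
by apply: measurable_funM => //; exact: measurableT_comp mf.
Qed.

Lemma modular_integrand_ge0 f lam y : 0 < lam -> 0 <= Phi (`|f y| / lam) * w y.
Proof. by move=> lam0; rewrite mulr_ge0// young_ge0// divr_ge0// ltW. Qed.

Lemma orlicz_norm_lt A f lam a : measurable A -> measurable_fun setT f ->
  0 < a -> wmeasure w A = a%:E -> (orlicz_norm Phi w A f < lam%:E)%E ->
  (\int[leb]_(y in A) (Phi (`|f y| / lam) * w y)%:E <= a%:E)%E.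
Proof.
move=> mA mf a0 wa /ereal_inf_lt[_ [mu [mu0 h] <-]]; rewrite lte_fin => mulam.
have lam0 : 0 < lam by exact: lt_trans mulam.
move: h; rewrite wa inver gt_eqF// lee_pdivrMl// mule1; apply: le_trans.
apply: ge0_le_integral => //.
- by move=> y _; rewrite lee_fin modular_integrand_ge0.
- by apply: measurable_funTS; exact: measurable_modular.
- by apply: measurable_funTS; exact: measurable_modular.
move=> y _; rewrite lee_fin ler_wpM2r// young_homo// ?divr_ge0 ?(ltW lam0)//.
by rewrite ler_wpM2l// lef_pV2 ?posrE// ltW.
Qed.

Lemma modular_indic A f lam : measurable A -> 0 < lam ->
  modular Phi w setT (fun y => lam^-1 * (f y * \1_A y)) =
  (\int[leb]_(y in A) (Phi (`|f y| / lam) * w y)%:E)%E.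
Proof.
move=> mA lam0; rewrite /modular [RHS]integral_mkcond.
apply: eq_integral => y _; rewrite patchE indicE.
case: ifPn => yA; rewrite ?mulr1 ?mulr0 ?normr0 ?young0 ?mul0r//.
by rewrite normrM gtr0_norm ?invr_gt0// [lam^-1 * _]mulrC.
Qed.

(** With L = 1 + b + Phi 1, convexity gives
    Phi ((h1 + h2) / (2 L mu)) <= (Phi (h1 / lam) + Phi 1) / (2 L), and the mean
    of the right-hand side is at most (b + Phi 1) / (2 L). *)
Lemma orlicz_norm_sum A (g h1 h2 : 'rV[R]_n -> R) a b lam mu :
  measurable A -> measurable_fun setT g -> measurable_fun setT h1 ->
  0 < a -> wmeasure w A = a%:E -> 0 <= b -> 0 < lam -> lam <= mu ->
  (\int[leb]_(y in A) (Phi (`|h1 y| / lam) * w y)%:E <= (b * a)%:E)%E ->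
  (forall y, A y -> `|h2 y| <= mu) ->
  {ae leb, forall y, `|g y| <= `|h1 y| + `|h2 y|} ->
  (orlicz_norm Phi w A g <= (2 * (1 + b + Phi 1) * mu)%:E)%E.
Proof.
move=> mA mg mh1 a0 wa b0 lam0 lammu h1le h2le gle.
have P10 : 0 <= Phi 1 by exact: young_ge0.
set L := 1 + b + Phi 1.
have L1 : 1 <= L by rewrite /L -addrA lerDl addr_ge0.
have L0 : 0 < L by exact: lt_le_trans L1.
have mu0 : 0 < mu by exact: lt_le_trans lammu.
have La0 : 0 < 2 * L * mu by rewrite !mulr_gt0.
apply: orlicz_norm_le => //; rewrite wa inver gt_eqF// lee_pdivrMl// mule1.
have c0 : 0 <= (2 * L)^-1 by rewrite invr_ge0 mulr_ge0// ltW.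
have cP0 : 0 <= (2 * L)^-1 * Phi 1 by rewrite mulr_ge0.
have mwA : measurable_fun A (fun y => (w y)%:E).
  by apply: measurable_funTS; exact/measurable_EFinP.
have wA0 y : A y -> (0 <= (w y)%:E)%E by rewrite lee_fin.
have mhA : measurable_fun A (fun y => (Phi (`|h1 y| / lam) * w y)%:E).
  by apply: measurable_funTS; exact: measurable_modular.
have hA0 y : A y -> (0 <= (Phi (`|h1 y| / lam) * w y)%:E)%E.
  by rewrite lee_fin modular_integrand_ge0.
apply: (@le_trans _ _ (\int[leb]_(y in A)
    (((2 * L)^-1)%:E * (Phi (`|h1 y| / lam) * w y)%:E +
     ((2 * L)^-1 * Phi 1)%:E * (w y)%:E))%E).
  apply: ae_ge0_le_integral => //.
  - by move=> y _; rewrite lee_fin modular_integrand_ge0.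
  - by apply: measurable_funTS; exact: measurable_modular.
  - move=> y _; rewrite -!EFinM -EFinD lee_fin addr_ge0// mulr_ge0//.
    exact: modular_integrand_ge0.
  - by apply: emeasurable_funD; exact: measurable_funeM.
  apply: filterS gle => y gy Ay; rewrite -!EFinM -EFinD lee_fin mulrA -mulrDl.
  rewrite ler_wpM2r// -mulrDr [in leRHS]invfM -[in leRHS]mulrA -[2 * L * mu]mulrA.
  have Lmu0 : 0 < L * mu by rewrite mulr_gt0.
  have L01 : 0 <= L^-1 <= 1 by rewrite invr_ge0 (ltW L0)/= invf_le1.
  set u := `|h1 y| / (L * mu); set v := `|h2 y| / (L * mu).
  have u0 : 0 <= u by rewrite divr_ge0// ltW.
  have v0 : 0 <= v by rewrite divr_ge0// ltW.
  have half : 0 <= (2^-1 : R) <= 1 by apply/andP; split; lra.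
  apply: (@le_trans _ _ (Phi (2^-1 * u + (1 - 2^-1) * v))).
    apply: young_homo => //.
      by rewrite divr_ge0// mulr_ge0// ltW.
    rewrite (_ : 2^-1 * u + _ = (`|h1 y| + `|h2 y|) / (2 * (L * mu))).
      by rewrite ler_wpM2r ?invr_ge0 ?mulr_ge0 ?(ltW L0) ?(ltW mu0).
    by rewrite /u /v; field; rewrite !gt_eqF.
  apply: (le_trans (young_convex yPhi half u0 v0)).
  rewrite (_ : 1 - 2^-1 = 2^-1 :> R); last by lra.
  rewrite -mulrDr ler_wpM2l ?invr_ge0// mulrDr; apply: lerD.
    rewrite /u invfM mulrCA.
    apply: le_trans (young_scale yPhi L01 _) _; first by rewrite divr_ge0// ltW.
    apply: ler_wpM2l; first by rewrite invr_ge0 ltW.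
    apply: young_homo => //; first by rewrite divr_ge0// ltW.
    by rewrite ler_wpM2l// lef_pV2.
  rewrite /v invfM mulrCA.
  apply: le_trans (young_scale yPhi L01 _) _; first by rewrite divr_ge0// ltW.
  apply: ler_wpM2l; first by rewrite invr_ge0 ltW.
  apply: young_homo => //; first by rewrite divr_ge0// ltW.
  by rewrite ler_pdivrMr// mul1r h2le.
rewrite ge0_integralD//; last 4 first.
- by move=> y _; rewrite -EFinM lee_fin mulr_ge0// modular_integrand_ge0.
- exact: measurable_funeM.
- by move=> y _; rewrite -EFinM lee_fin mulr_ge0.
- exact: measurable_funeM.
rewrite (ge0_integralZl_EFin leb mA hA0 mhA c0).
rewrite (ge0_integralZl_EFin leb mA wA0 mwA cP0).
apply: (@le_trans _ _ (((2 * L)^-1)%:E * (b * a)%:E +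
    ((2 * L)^-1 * Phi 1)%:E * a%:E)%E).
  by apply: leeD; [apply: lee_wpmul2l; rewrite ?lee_fin|rewrite -wa].
rewrite -!EFinM -EFinD lee_fin -mulrA -mulrDr -mulrDl mulrA ler_piMl ?(ltW a0)//.
rewrite ler_pdivrMl ?mulr_gt0// mulr1.
apply: (@le_trans _ _ L); first by rewrite /L -addrA lerDr.
by rewrite ler_peMl ?(ltW L0)// ler1n.
Qed.

End orlicz_norm_theory.

(** * Boundedness on Orlicz-Morrey spaces *)

Theorem theorem7p1 (R : realType) (n : nat) (Phi : R -> R) (p : R)
    (w : 'rV[R]_n -> R) (D : set ('rV[R]_n -> R))
    (S : ('rV[R]_n -> R) -> ('rV[R]_n -> R))
    (phi psi : 'rV[R]_n -> R -> R) (c1 c2 : R) :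
  (0 < n)%N ->
  young_function Phi ->
  delta2 (conjugate Phi) ->
  0 < upper_index Phi -> upper_index Phi = p^-1 -> p^-1 < 1 ->
  muckenhoupt p w ->
  sublinear_operator D S ->
  orlicz_space Phi w `<=` D ->
  (forall f, D f ->
    (modular Phi w setT (S f) <= c1%:E * modular Phi w setT f)%E) ->
  (forall (z : 'rV[R]_n) (l : R) f, 0 < l -> D f ->
    supp f `<=` ~` cube z (2 * l) ->
    forall x, cube z l x ->
    (`|S f x|%:E <=
      \int[@lebesgueRn R n]_y (`|f y| / enorm (x - y) ^+ n)%:E)%E) ->
  morrey_function phi ->
  morrey_function psi ->
  (forall (x : 'rV[R]_n) (l : R), 0 < l ->
    ((psi x l)%:E *
      \int[@lebesgue_measure R]_(t in `[l, +oo[)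
        ((phi x t)%:E^-1 * (t^-1)%:E) <= c2%:E)%E) ->
  exists c : R, 0 < c /\
    forall f, D f ->
      (morrey_norm Phi psi w (S f) <= c%:E * morrey_norm Phi phi w f)%E.
Proof.
move=> n0 yPhi _ u0 up pV1 Ap [Dm [D0 DD DZ] mS Sadd Shom] LD Smod Sker
  [_ phih phi0] [_ psih psi0] phipsi.
have p0 : 0 < p by rewrite -invr_gt0 -up.
have p1 : 1 < p by rewrite -invf_lt1.
have [[mw w0 wae _] _] := Ap.
have [M M0 dbl] := weight_doubling p1 Ap.
have [C C0 avg] := average_le_orlicz p1 Ap yPhi u0 up.
set leb := @lebesgueRn R n.
have P10 : 0 <= Phi 1 by exact: young_ge0.
have phi_ge0 x t : 0 <= t -> 0 <= phi x t.
  by move=> t0; rewrite -(phi0 x); apply: phih; rewrite ?in_itv/= ?lexx ?t0.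
have psi_ge0 x t : 0 <= t -> 0 <= psi x t.
  by move=> t0; rewrite -(psi0 x); apply: psih; rewrite ?in_itv/= ?lexx ?t0.
(* A accounts for the height of S f1 and for the pointwise bound of S f2 *)
pose A := 1 + C * 8 ^+ n.
have A0 : 0 < A by rewrite addr_gt0// mulr_gt0// exprn_gt0.
have A1 : 1 <= A by rewrite /A lerDl mulr_ge0 ?exprn_ge0// ltW.
pose L := 1 + `|c1| * M + Phi 1.
have L0 : 0 < L.
  by rewrite /L -addrA ltr_pwDl// addr_ge0// mulr_ge0// ltW.
pose c := 4 * L * A * (`|c2| + 1).
have c0 : 0 < c by rewrite /c !mulr_gt0// ltr_wpDl.
exists c; split=> // f Df.
have mf : measurable_fun setT f by exact: Dm.
have morrey_ge0 : (0 <= morrey_norm Phi phi w f)%E.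
  apply: le_trans (ereal_sup_ubound _) => /=; last by exists (0, 1) => /=.
  by rewrite mule_ge0 ?orlicz_norm_ge0// lee_fin phi_ge0.
case E : (morrey_norm Phi phi w f) morrey_ge0 => [m||//] morrey_ge0; last first.
  by rewrite gt0_muley ?lte_fin// leey.
rewrite lee_fin in morrey_ge0.
apply: ge_ereal_sup => _ [[z l] /= l0 <-].
have [->|psn0] := eqVneq (psi z l) 0.
  by rewrite mul0e -EFinM lee_fin mulr_ge0// ltW.
have ps0 : 0 < psi z l by rewrite lt_neqAle eq_sym psn0 psi_ge0// ltW.
set ps := psi z l in ps0 *.
pose F t : \bar R := ((phi z t)%:E^-1)%E.
have Ile : (\int[@lebesgue_measure R]_(t in `[l, +oo[) (F t * (t^-1)%:E) <=
    (c2 / ps)%:E)%E.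
  by rewrite mulrC EFinM lee_pdivlMl//; exact: phipsi.
have F_ge0 t : l <= t -> (0 <= F t)%E.
  move=> lt; rewrite /F inver; case: ifPn => // _.
  by rewrite lee_fin invr_ge0 phi_ge0// (le_trans (ltW l0)).
pose be := 2 * (c2 / ps).
have dyad b N : (forall j, 0 <= b j) ->
    (forall j t, 2 ^+ j * l <= t < 2 ^+ j.+1 * l -> ((b j)%:E <= F t)%E) ->
    \sum_(j < N) b j <= be.
  move=> b0 bF; rewrite -lee_fin.
  apply: le_trans (dyadic_sum_le_integral N l0 F_ge0 b0 bF) _.
  by rewrite /be EFinM; apply: lee_wpmul2l.
have pow0 j : 0 < 2 ^+ j * l by rewrite mulr_gt0// exprn_gt0.
have phiM s t : 0 <= s -> s <= t -> phi z s <= phi z t.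
  by move=> s0 st; apply: phih; rewrite ?in_itv/= ?s0 ?(le_trans s0 st).
(* otherwise 1 / phi is infinite on [l, 2 l[, where dyad would bound every
   constant *)
have phi2l : 0 < phi z (2 * l).
  rewrite lt_neqAle phi_ge0 ?mulr_ge0 ?(ltW l0)// andbT eq_sym.
  apply/negP => /eqP phi2.
  pose b j : R := if j == 0%N then `|be| + 1 else 0.
  have b0 j : 0 <= b j by rewrite /b; case: ifPn.
  have bF j t : 2 ^+ j * l <= t < 2 ^+ j.+1 * l -> ((b j)%:E <= F t)%E.
    rewrite /b; case: ifPn => [/eqP->|_].
      rewrite expr0 mul1r expr1 => /andP[lt t2l].
      have -> : F t = +oo%E; last by rewrite leey.
      rewrite /F inver ifT// eq_le phi_ge0 ?(le_trans (ltW l0))// andbT -phi2.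
      by rewrite phiM ?(ltW t2l)// (le_trans (ltW l0)).
    move=> /andP[lt _]; apply: F_ge0; apply: le_trans lt.
    by rewrite ler_peMl ?(ltW l0)// exprn_ege1// ler1n.
  have := dyad b 1%N b0 bF; rewrite big_ord1 /b/= leNgt.
  by rewrite ltr_pwDr// ler_norm.
have phij j : 0 < phi z (2 ^+ j.+1 * l).
  apply: lt_le_trans phi2l _; rewrite phiM ?mulr_ge0 ?(ltW l0)//.
  by rewrite ler_pM2r// exprS ler_peMr// exprn_ege1// ler1n.
pose a j := (phi z (2 ^+ j.+1 * l))^-1.
have a0 j : 0 < a j by rewrite invr_gt0.
have suma N : \sum_(j < N) a j <= be.
  apply: dyad => [j|j t /andP[jt tj]]; first exact: ltW.
  rewrite /F inver; case: ifPn => [_|]; first exact: leey.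
  have t0 : 0 <= t by rewrite (le_trans _ jt)// ltW.
  move=> phit; rewrite lee_fin lef_pV2 ?posrE//; first by rewrite phiM// ltW.
  by rewrite lt_neqAle eq_sym phit phi_ge0.
have be0 : 0 < be.
  by apply: lt_le_trans (suma 1%N); rewrite big_ord1.
(* m' > m because the infimum that defines the norm need not be attained *)
have key m' : m < m' ->
    (ps%:E * orlicz_norm Phi w (cube z l) (S f) <= (c * m')%:E)%E.
  move=> mm'; have m'0 : 0 < m' by exact: le_lt_trans mm'.
  pose lam j := m' * a j.
  have lam0 j : 0 < lam j by rewrite mulr_gt0.
  have adm j : (orlicz_norm Phi w (cube z (2 ^+ j.+1 * l)) f < (lam j)%:E)%E.
    apply: (@le_lt_trans _ _ (a j * m)%:E); last first.
      by rewrite lte_fin /lam mulrC ltr_pM2r.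
    rewrite EFinM /a lee_pdivlMl// -E.
    by apply: ereal_sup_ubound; exists (z, 2 ^+ j.+1 * l) => /=.
  have modf j b : 0 < b -> wmeasure w (cube z (2 ^+ j.+1 * l)) = b%:E ->
      (\int[leb]_(y in cube z (2 ^+ j.+1 * l)) (Phi (`|f y| / lam j) * w y)%:E
        <= b%:E)%E.
    by move=> b0 wb; apply: orlicz_norm_lt => //; exact: measurable_cube.
  have avgf j : (\int[leb]_(y in cube z (2 ^+ j * l)) `|f y|%:E <=
      (C * lam j * (2 ^+ j * l) ^+ n)%:E)%E.
    apply: avg => //; rewrite mulrA -exprS.
    have [b b0 wb] := weight_cube_fin Ap z (pow0 j.+1).
    by rewrite wb inver gt_eqF// lee_pdivrMl// mule1 modf.
  have four : 4 * l = 2 ^+ 2 * l by congr (_ * l); ring.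
  set Q := cube z l; set Q4 := cube z (4 * l).
  have mQ : measurable Q by exact: measurable_cube.
  have mQ4 : measurable Q4 by exact: measurable_cube.
  have [b b0 wb] := weight_cube_fin Ap z l0.
  have l40 : 0 < 4 * l by rewrite mulr_gt0.
  have [b4 b40 wb4] := weight_cube_fin Ap z l40.
  have b4M : b4 <= M * b by exact: dbl wb wb4.
  (* f1' is f1 divided by the height at which its modular is controlled; it
     lies in the Orlicz space, so that f1 and f2 lie in the domain of S *)
  pose f1 y := f y * \1_Q4 y.
  pose f1' y := (lam 1%N)^-1 * f1 y.
  have mf1 : measurable_fun setT f1.
    by apply: measurable_funM => //; exact: measurable_indic.
  have mf1' : measurable_fun setT f1' by exact: measurable_funM.
  have modf1' : (modular Phi w setT f1' <= b4%:E)%E.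
    rewrite /f1' /f1 modular_indic//.
    by have := modf 1%N b4 b40; rewrite -four; apply.
  have Df1' : D f1'.
    apply: LD; split=> //; exists 1 => //.
    rewrite (_ : (fun y => f1' y / 1) = f1').
      by apply: le_lt_trans modf1' _; exact: ltry.
    by apply/funext => y; rewrite divr1.
  have Df1 : D f1.
    rewrite (_ : f1 = fun y => lam 1%N * f1' y); first exact: DZ.
    by apply/funext => y; rewrite /f1' mulrA divff ?mul1r// gt_eqF.
  pose f2 y := f y + (-1) * f1 y.
  have Df2 : D f2 by apply: DD => //; exact: DZ.
  have f12 : (fun y => f1 y + f2 y) = f.
    by apply/funext => y; rewrite /f2; ring.
  have Sf_le : {ae leb, forall y, `|S f y| <= `|S f1 y| + `|S f2 y|}.
    by have := Sadd _ _ Df1 Df2; rewrite f12.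
  have f2Q4 y : Q4 y -> f2 y = 0.
    by move=> Qy; rewrite /f2 /f1 indicE mem_set// mulr1 mulN1r subrr.
  have f2f y : `|f2 y| <= `|f y|.
    have [Qy|nQ] := pselect (Q4 y); first by rewrite f2Q4// normr0.
    by rewrite /f2 /f1 indicE memNset// mulr0 mulr0 addr0.
  pose mu := A * (m' * be).
  have mbe0 : 0 < m' * be by rewrite mulr_gt0.
  have lam_mu : lam 1%N <= mu.
    apply: (@le_trans _ _ (m' * be)); last by rewrite ler_peMl// ltW.
    rewrite ler_pM2l//; apply: le_trans (suma 2%N).
    by rewrite !big_ord_recl big_ord0 addr0/= lerDr ltW.
  have Sf1_le : (\int[leb]_(y in Q) (Phi (`|S f1 y| / lam 1%N) * w y)%:E <=
      ((`|c1| * M) * b)%:E)%E.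
    have mSf1 := measurable_modular yPhi mw (mS _ Df1) (lam0 1%N).
    apply: (@le_trans _ _ (\int[leb]_y (Phi (`|S f1 y| / lam 1%N) * w y)%:E)%E).
      apply: ge0_subset_integral => //.
      by move=> y _; rewrite lee_fin; exact: (modular_integrand_ge0 yPhi w0).
    apply: (@le_trans _ _ (modular Phi w setT (S f1'))).
      apply: ae_ge0_le_integral => //.
      - by move=> y _; rewrite lee_fin; exact: (modular_integrand_ge0 yPhi w0).
      - by move=> y _; rewrite lee_fin mulr_ge0// young_ge0.
      - apply/measurable_EFinP; apply: measurable_funM => //.
        apply: measurable_young => //.
        by apply: measurableT_comp => //; exact: mS.
      apply: filterS (Shom (lam 1%N)^-1 _ Df1) => y -> _.
      by rewrite [`|(lam 1%N)^-1|]gtr0_norm ?invr_gt0// [(lam 1%N)^-1 * _]mulrC.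
    apply: le_trans (Smod _ Df1') _.
    have mod0 : (0 <= modular Phi w setT f1')%E.
      by apply: integral_ge0 => y _; rewrite lee_fin mulr_ge0// young_ge0.
    apply: (@le_trans _ _ (`|c1|%:E * b4%:E)%E).
      apply: (@le_trans _ _ (`|c1|%:E * modular Phi w setT f1')%E).
        by apply: lee_wpmul2r => //; rewrite lee_fin ler_norm.
      by apply: lee_wpmul2l => //; rewrite lee_fin.
    by rewrite -EFinM lee_fin -mulrA ler_wpM2l.
  have Sf2_le y : Q y -> `|S f2 y| <= mu.
    move=> Qy; rewrite -lee_fin.
    apply: le_trans (Sker z l f2 l0 Df2 (supp_sub_cube l0 f2Q4) y Qy) _.
    apply: le_trans (kernel_integral_le l0 (Dm _ Df2) f2Q4 Qy) _.
    apply: lime_le.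
      apply: is_cvg_nneseries => j _ _; apply: mule_ge0.
        by rewrite lee_fin invr_ge0 exprn_ge0// ltW.
      by apply: integral_ge0 => u _; rewrite lee_fin.
    apply: nearW => N; rewrite big_mkord.
    apply: (@le_trans _ _ (\sum_(j < N) (C * 8 ^+ n * m' * a j.+3)%:E)%E).
      apply: lee_sum => j _; rewrite lee_pdivrMl ?exprn_gt0//.
      apply: (@le_trans _ _ (C * lam j.+3 * (2 ^+ j.+3 * l) ^+ n)%:E).
        apply: le_trans (avgf j.+3); apply: ge0_le_integral => //.
        - exact: measurable_cube.
        - apply: measurable_funTS; apply/measurable_EFinP.
          by apply: measurableT_comp => //; exact: Dm.
        - by apply: measurable_funTS; apply/measurable_EFinP;
            exact: measurableT_comp mf.
        by move=> u _; rewrite lee_fin.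
      rewrite -EFinM lee_fin /lam.
      rewrite (_ : 2 ^+ j.+3 * l = 8 * (2 ^+ j * l)); last by rewrite !exprS; ring.
      by rewrite exprMn le_eqVlt; apply/orP; left; apply/eqP; ring.
    rewrite sumEFin lee_fin -mulr_sumr.
    have sum3 : \sum_(j < N) a j.+3 <= be.
      apply: le_trans (suma N.+3); rewrite !big_ord_recl/= !addrA lerDr.
      by rewrite !addr_ge0// ltW.
    apply: (@le_trans _ _ (C * 8 ^+ n * m' * be)).
      by rewrite ler_wpM2l// !mulr_ge0 ?exprn_ge0// ltW.
    rewrite -mulrA /mu ler_wpM2r ?(ltW mbe0)//.
    by rewrite /A lerDr.
  have cM0 : 0 <= `|c1| * M by rewrite mulr_ge0// ltW.
  have := orlicz_norm_sum yPhi w0 mw mQ (mS _ Df) (mS _ Df1) b0 wb cM0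
    (lam0 1%N) lam_mu Sf1_le Sf2_le Sf_le.
  move=> nle; apply: (@le_trans _ _ (ps%:E * (2 * L * mu)%:E)%E).
    by apply: lee_wpmul2l => //; rewrite lee_fin ltW.
  rewrite -EFinM lee_fin (_ : ps * _ = 4 * L * A * c2 * m'); last first.
    by rewrite /mu /be; field; rewrite gt_eqF.
  rewrite ler_pM2r// /c ler_pM2l ?mulr_gt0//.
  by rewrite (le_trans (ler_norm c2))// lerDl.
apply/lee_addgt0Pr => e e0; rewrite -EFinM -EFinD.
have := key (m + e / c); rewrite ltrDl divr_gt0// => /(_ isT).
by rewrite mulrDr [c * (e / c)]mulrC divfK ?gt_eqF.
Qed.
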